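(* Let $\xi(t)=\sum_{p\ge 1}\beta_p^2t^p$ with real coefficients $\beta_p$ and $\xi(1+\epsilon)<\infty$ for some $\epsilon>0$, let $\mu$ be a Borel probability measure on $[0,1]$, and let $u$ be the corresponding solution to the Parisi PDE. Then $|u_x|<1$ and $0<u_{xx}\le1$ on $[0,1]\times\mathbb{R}$.
   Context: The solution to the Parisi PDE corresponding to $\mu$ is the unique weak solution $u$ of \[ \partial_tu+\frac{\xi''(t)}{2}\left(\partial_{xx}u+\mu[0,t](\partial_xu)^2\right)=0\ \text{ on }(0,1)\times\mathbb{R},\qquad u(1,x)=\log\cosh x , \] i.e. the unique continuous $u:[0,1]\times\mathbb{R}\to\mathbb{R}$ with essentially bounded weak derivative $\partial_xu$ such that \[ 0=\int_0^1\int_{\mathbb{R}}-u\,\partial_t\phi+\frac{\xi''(t)}{2}\left(u\,\partial_{xx}\phi+\mu[0,t](\partial_xu)^2\phi\right)dx\,dt+\int_{\mathbb{R}}\phi(1,x)\log\cosh x\,dx \] for every $\phi\in C_c^\infty((0,1]\times\mathbb{R})$. (Existence and uniqueness hold, and all spatial derivatives $\partial_x^ju$, $j\ge1$, are bounded and continuous on $[0,1]\times\mathbb{R}$.) *)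

(* Defs.v *)
From HB Require Import structures.
From mathcomp Require Import all_boot all_order all_algebra.
From mathcomp Require Import all_classical all_reals all_analysis.
Set Implicit Arguments.
Unset Strict Implicit.
Unset Printing Implicit Defensive.
Import Order.TTheory GRing.Theory Num.Theory.
Import numFieldNormedType.Exports.
Local Open Scope ring_scope.
Local Open Scope classical_set_scope.

Section ParisiPDE.
Context {R : realType}.

(* The coefficient [beta 0] is unused. *)
Definition xi (beta : nat -> R) (t : R) : R :=
  \big[+%R/0]_(1 <= p <oo) (beta p ^+ 2 * t ^+ p).

Definition cosh (x : R) : R := (expR x + expR (- x)) / 2.

(* Functions of (t, x) are curried, time first. *)
Definition pt (f : R -> R -> R) : R -> R -> R := fun t x => derive1 (f ^~ x) t.
Definition px (f : R -> R -> R) : R -> R -> R := fun t x => derive1 (f t) x.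

(* C^infty(R^2): [s] lists the partial derivatives that are taken successively,
   [true] for d/dt and [false] for d/dx. *)
Definition partials (s : seq bool) (f : R -> R -> R) : R -> R -> R :=
  foldr (fun b => if b then pt else px) f s.

Definition smooth (f : R -> R -> R) : Prop :=
  forall s : seq bool,
    continuous (uncurry (partials s f)) /\
    forall t x : R, derivable ((partials s f) ^~ x) t 1 /\
                    derivable (partials s f t) x 1.

(* C_c^infty(Omega) for Omega open in R^2, extended by 0 outside Omega. *)
Definition test_function (Omega : set (R * R)) (phi : R -> R -> R) : Prop :=
  smooth phi /\
  exists K : set (R * R),
    [/\ compact K, K `<=` Omega & forall t x, ~ K (t, x) -> phi t x = 0].

Definition iint (f : R -> R -> R) : R :=
  \int[lebesgue_measure]_(t in `]0, 1[) \int[lebesgue_measure]_x f t x.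

Definition weak_px (u v : R -> R -> R) : Prop :=
  forall phi, test_function (`]0, 1[ `*` setT) phi ->
    iint (fun t x => u t x * px phi t x) = - iint (fun t x => v t x * phi t x).

(* Since [v] only matters up to null sets, it may be taken Borel. *)
Definition essentially_bounded (v : R -> R -> R) : Prop :=
  measurable_fun (`]0, 1[ `*` setT : set (R * R)) (uncurry v) /\
  exists M : R, {ae (lebesgue_measure \x lebesgue_measure)%E,
    forall z : R * R, (`]0, 1[ `*` setT) z -> `|uncurry v z| <= M}.

(* The elements of C_c^infty((0,1] x R) are the restrictions to (0,1] x R of the
   elements of C_c^infty((0,+oo) x R). *)
Definition parisi_solution (xi : R -> R) (mu : set R -> \bar R)
    (u : R -> R -> R) : Prop :=
  {within `[0, 1] `*` setT, continuous (uncurry u)} /\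
  exists v : R -> R -> R,
    [/\ weak_px u v, essentially_bounded v &
      forall phi, test_function (`]0, +oo[ `*` setT) phi ->
        0 = iint (fun t x => - (u t x * pt phi t x) +
               derive1n 2 xi t / 2 * (u t x * px (px phi) t x +
                                fine (mu `[0, t]) * v t x ^+ 2 * phi t x)) +
            \int[lebesgue_measure]_x (phi 1 x * ln (cosh x))].

Definition bounded_space_derivatives (u : R -> R -> R) : Prop :=
  (forall (j : nat) (t x : R), 0 <= t <= 1 -> derivable (derive1n j (u t)) x 1) /\
  forall j : nat, (1 <= j)%N ->
    {within `[0, 1] `*` setT, continuous (fun z : R * R => derive1n j (u z.1) z.2)} /\
    exists M : R, forall t x : R, 0 <= t <= 1 -> `|derive1n j (u t) x| <= M.

End ParisiPDE.

(* Main.v *)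
Require Import Defs.
From HB Require Import structures.
From mathcomp Require Import all_boot all_order all_algebra.
From mathcomp Require Import all_classical all_reals all_analysis.
From mathcomp Require Import measurable_realfun ring lra.
Set Implicit Arguments.
Unset Strict Implicit.
Unset Printing Implicit Defensive.
Import Order.TTheory GRing.Theory Num.Theory.
Import numFieldNormedType.Exports.
Local Open Scope ring_scope.
Local Open Scope classical_set_scope.

(** Write p = u_x, w = u_xx, A = xi'' / 2 and m(t) = mu[0,t]. Testing the weak
    equation against tensor products a(t) b(x) shows that v = u_x almost
    everywhere, that u(1, .) = log cosh and, since m is right-continuous, that
    p and w have right time derivatives
      p_t = - A (p_xx + 2 m p p_x)  and
      w_t = - A (w_xx + 2 m p w_x + 2 m w^2).
    Let L f = f_t + A (f_xx + 2 m p f_x). A bounded continuous f with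
    f(1, .) <= 0 and L f >= 0 is nonpositive; right time derivatives suffice
    for this maximum principle. It is applied twice.
    - L (w + p^2) = 2 A (1 - m) w^2 >= 0 and w + p^2 = 1 at time 1, hence
      w <= 1 - p^2.
    - L w <= 0 and L g >= 0 for g(t, x) = exp (- K (1 - t)) sech^2 x with K
      large, and w = g at time 1, hence w >= g > 0.
    The two bounds together give |p| < 1. *)

(** * Smooth functions of one variable *)

(** The obstacle is regularity in time. Only space derivatives are controlled by hypothesis, and m
    may jump, so p and w need not have two-sided time derivatives. Two choices meet this. Kernels in
    time are supported strictly to the right of their base point, so that only right limits of m
    enter. And at a maximum reached at a time before 1 only later times have to be compared, so
    right derivatives are enough, even at time 0.

    With tensor products every space derivative can be moved onto b. The equations for p and w
    therefore follow from the one for u by testing with b' and b'', and u_t is never differentiated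
    in space.

    The comparison functions are dictated by time 1, where p = tanh and w = 1 - tanh^2 = sech^2. The
    sign of L (w + p^2) rests on m <= 1, and that of L w = - 2 A m w^2 on m >= 0. If A <= S and |p|
    <= M, then K = S (2 + 4 M) is large enough for the barrier. As x ranges over the whole line, the
    maximum principle penalises by log cosh, which grows linearly and has first and second
    derivatives bounded by 1. *)

Section smooth_functions.
Context {R : realType}.
Implicit Types (f g : R -> R) (a b s h x y : R).

Lemma is_derive_congr f g x (d e : R) :
  is_derive x (1 : R) f d -> f =1 g -> d = e -> is_derive x (1 : R) g e.
Proof. by move=> H /funext <- <-. Qed.

Lemma is_derive_add f g x (d e : R) :
  is_derive x (1 : R) f d -> is_derive x (1 : R) g e ->
  is_derive x (1 : R) (fun y => f y + g y) (d + e).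
Proof. exact: is_deriveD. Qed.

Lemma is_derive_sub f g x (d e : R) :
  is_derive x (1 : R) f d -> is_derive x (1 : R) g e ->
  is_derive x (1 : R) (fun y => f y - g y) (d - e).
Proof. exact: is_deriveB. Qed.

Lemma is_derive_mul f g x (d e : R) :
  is_derive x (1 : R) f d -> is_derive x (1 : R) g e ->
  is_derive x (1 : R) (fun y => f y * g y) (d * g x + f x * e).
Proof.
move=> Hf Hg; apply: (is_derive_congr (is_deriveM Hf Hg)) => //.
by rewrite /GRing.scale/= addrC [g x * d]mulrC.
Qed.

Lemma is_derive_inv f x (d : R) :
  is_derive x (1 : R) f d -> f x != 0 ->
  is_derive x (1 : R) (fun y => (f y)^-1) (- d / f x ^+ 2).
Proof.
move=> Hf fx0; apply: (is_derive_congr (is_deriveV fx0 Hf)) => //.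
by rewrite /GRing.scale/= -exprVn mulNr mulNr mulrC.
Qed.

Lemma is_derive_comp f g x (d e : R) :
  is_derive (g x) (1 : R) f d -> is_derive x (1 : R) g e ->
  is_derive x (1 : R) (fun y => f (g y)) (d * e).
Proof. exact: is_derive1_comp. Qed.

Lemma is_derive_affine x (c d : R) : is_derive x (1 : R) (fun y => c * y + d) c.
Proof.
apply: (is_derive_congr (is_derive_add
  (is_derive_mul (is_derive_cst c x 1) (is_derive_id x 1))
  (is_derive_cst d x 1))) => //.
by rewrite mul0r add0r /cst mulr1 addr0.
Qed.

Lemma is_derive_comp_affine f x (c d e : R) :
  is_derive (c * x + d) (1 : R) f e ->
  is_derive x (1 : R) (fun y => f (c * y + d)) (e * c).
Proof.
move=> H; apply: (@is_derive_comp f (fun y => c * y + d)) => //.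
exact: is_derive_affine.
Qed.

(** The derivative is an existential witness, so closure under the algebraic operations is a plain
    induction. [Ck n] is n-fold differentiability: the last derivative need not be continuous, which
    makes no difference once all [n] are required. *)
Fixpoint Ck (n : nat) f : Prop :=
  if n is m.+1 then
    exists g, (forall x, is_derive x (1 : R) f (g x)) /\ Ck m g
  else True.

Definition smooth1 f := forall n, Ck n f.

Lemma CkW n f : Ck n.+1 f -> Ck n f.
Proof.
elim: n f => [//|n IHn] f [g [fg Ckg]].
by exists g; split => //; exact: IHn.
Qed.

Lemma Ck_ext n f g : f =1 g -> Ck n f -> Ck n g.
Proof. by move=> /funext ->. Qed.

Lemma Ck_cst n (k : R) : Ck n (cst k).
Proof.
elim: n k => [//|n IHn] k.
by exists (cst 0); split => // x; exact: is_derive_cst.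
Qed.

Lemma CkD n f g : Ck n f -> Ck n g -> Ck n (fun x => f x + g x).
Proof.
elim: n f g => [//|n IHn] f g [f' [Hf Cf]] [g' [Hg Cg]].
exists (fun x => f' x + g' x); split; last exact: IHn.
by move=> x; exact: is_deriveD.
Qed.

Lemma CkM n f g : Ck n f -> Ck n g -> Ck n (fun x => f x * g x).
Proof.
elim: n f g => [//|n IHn] f g Cf Cg.
move: (Cf) (Cg) => [f' [Hf Cf']] [g' [Hg Cg']].
exists (fun x => f x * g' x + g x * f' x); split; last first.
  by apply: CkD; apply: IHn => //; exact: CkW.
by move=> x; have := is_deriveM (Hf x) (Hg x).
Qed.

Lemma CkN n f : Ck n f -> Ck n (fun x => - f x).
Proof.
move=> Cf; apply: (@Ck_ext _ (fun x => cst (-1) x * f x)).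
  by move=> x /=; rewrite mulN1r.
by apply: CkM => //; exact: Ck_cst.
Qed.

Lemma CkV n f : (forall x, f x != 0) -> Ck n f -> Ck n (fun x => (f x)^-1).
Proof.
move=> f0; elim: n => [//|n IHn] Cf.
move: (Cf) => [f' [Hf Cf']].
exists (fun x => - f' x * ((f x)^-1 * (f x)^-1)); split; last first.
  apply: CkM; first exact: CkN.
  by apply: CkM; apply: IHn; exact: CkW.
by move=> x; rewrite -invfM; exact: (is_derive_inv (Hf x)).
Qed.

Lemma Ck_affine n f (c d : R) : Ck n f -> Ck n (fun x => f (c * x + d)).
Proof.
elim: n f => [//|n IHn] f [f' [Hf Cf]].
exists (fun x => cst c x * f' (c * x + d)); split; last first.
  by apply: CkM; [exact: Ck_cst | exact: IHn].
move=> x; rewrite /cst mulrC.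
exact: is_derive_comp_affine.
Qed.

Lemma smooth1_derive1 f : smooth1 f -> smooth1 f^`().
Proof.
move=> Cf n; have [g [Hg Cg]] := Cf n.+1.
by apply: Ck_ext Cg => x; rewrite derive1E; apply/esym/derive_val.
Qed.

Lemma smooth1_derive1n n f : smooth1 f -> smooth1 (derive1n n f).
Proof.
by move=> Cf; elim: n => [//|n IHn]; rewrite derive1nS; exact: smooth1_derive1.
Qed.

Lemma smooth1_derivable f x : smooth1 f -> derivable f x 1.
Proof. by move=> /(_ 1%N) [g [Hg _]]; exact: ex_derive. Qed.

Lemma smooth1_continuous f : smooth1 f -> continuous f.
Proof.
by move=> Cf x; apply/differentiable_continuous/derivable1_diffP/smooth1_derivable.
Qed.

Lemma smooth1_is_derive f x : smooth1 f -> is_derive x (1 : R) f (f^`() x).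
Proof.
by move=> Cf; rewrite derive1E; apply: derivableP; exact: smooth1_derivable.
Qed.

End smooth_functions.

(** * Bumps and test functions *)

Section flat_function.
Context {R : realType}.
Implicit Types (f g : R -> R) (a b s h x y : R).

Lemma is_derive_cvg f x (d : R) :
  h^-1 *: (f (h *: 1 + x) - f x) @[h --> 0^'] --> d -> is_derive x (1 : R) f d.
Proof.
move=> fd; constructor; last exact: cvg_lim.
by apply/cvg_ex; exists d.
Qed.

Lemma is_derive_quadratic_bound f x (C : R) :
  (forall y, `|f y - f x| <= C * (y - x) ^+ 2) -> is_derive x (1 : R) f 0.
Proof.
move=> fC; apply: is_derive_cvg.
have C0 : 0 <= C.
  have := fC (x + 1); rewrite addrAC subrr add0r expr1n mulr1.
  exact: le_trans.
apply/cvgrPdist_lt => e e0; near=> h.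
have h0 : h != 0 by near: h; exact: nbhs_dnbhs_neq.
rewrite sub0r normrN normrZ normfV ltr_pdivrMl ?normr_gt0//.
apply: le_lt_trans (fC _) _.
rewrite [h *: 1]mulr1 addrK -real_normK ?num_real// expr2 mulrCA.
rewrite ltr_pM2l ?normr_gt0//.
have : `|h| < e / (C + 1).
  by near: h; apply: dnbhs0_lt; rewrite divr_gt0// ltr_wpDl.
rewrite ltr_pdivlMr ?ltr_wpDl// => he.
by apply: le_lt_trans he; rewrite mulrC ler_wpM2l// lerDl.
Unshelve. all: by end_near. Qed.

(** The powers of 1/x make the family closed under differentiation: [flat k] has derivative
    [flat (k + 2) - k * flat (k + 1)], so smoothness to every order is a single induction. *)
Definition flat (k : nat) x : R := if 0 < x then expR (- x^-1) * (x^-1) ^+ k else 0.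

Lemma flat_ge0 k x : 0 <= flat k x.
Proof.
rewrite /flat; case: ifPn => // x0.
by rewrite mulr_ge0 ?expR_ge0// exprn_ge0// invr_ge0 ltW.
Qed.

(** The exponential series gives exp y >= y^(k+2) / (k+2)! at y = 1/x. Such a quadratic bound is all
    that a zero derivative at 0 requires. *)
Lemma flat_le_sqr k x : flat k x <= (k.+2)`!%:R * x ^+ 2.
Proof.
rewrite /flat; case: ifPn => [x0|_]; last by rewrite mulr_ge0 ?sqr_ge0.
have xV0 : 0 <= x^-1 by rewrite invr_ge0 ltW.
have := expR_ge1Dxn k.+1 xV0.
rewrite expRN => H.
have f0 : 0 < (k.+2)`!%:R :> R by rewrite ltr0n fact_gt0.
rewrite ler_pdivrMl ?expR_gt0//.
apply: (@le_trans _ _ ((x^-1 ^+ k.+2 / (k.+2)`!%:R) * ((k.+2)`!%:R * x ^+ 2))).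
  rewrite le_eqVlt; apply/orP; left; apply/eqP.
  rewrite mulrA divfK ?gt_eqF// -addn2 exprD -mulrA -exprMn mulVf ?gt_eqF//.
  by rewrite expr1n mulr1.
apply: ler_wpM2r; first by rewrite mulr_ge0 ?sqr_ge0.
apply: le_trans H; rewrite lerDr//.
Qed.

Lemma is_derive_flat k x :
  is_derive x (1 : R) (flat k) (flat k.+2 x - k%:R * flat k.+1 x).
Proof.
have [x0|x0|->] := ltgtP x 0.
- rewrite {2 3}/flat ltNge (ltW x0)/= mulr0 subr0.
  apply: (@near_eq_is_derive _ _ _ (cst 0)).
  near=> y; rewrite /flat ltNge; suff -> : y <= 0 by [].
  by near: y; exact: lt_le_nbhsl.
- apply: (@near_eq_is_derive _ _ _ (fun y => expR (- y^-1) * (y^-1) ^+ k)).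
    near=> y; rewrite /flat; suff -> : 0 < y by [].
    by near: y; exact: lt_nbhsr.
  rewrite /flat x0.
  have xn0 : id x != 0 by rewrite gt_eqF.
  have HV := is_deriveV xn0 (is_derive_id x 1).
  have H1 := @is_derive1_comp _ expR (fun y => - y^-1) x _ _ (is_derive_expR _) (is_deriveN HV).
  have H2 := is_deriveX k HV.
  have H := is_deriveM H1 H2.
apply: (is_derive_congr H) => //.
  by move=> y; rewrite !fctE.
rewrite !fctE /GRing.scale/= -!exprVn.
by case: k {H H2} => [|k]; rewrite !exprS ?expr0/=; ring.
- rewrite {2 3}/flat ltxx mulr0 subr0.
  apply: (@is_derive_quadratic_bound _ _ (k.+2)`!%:R) => y.
  by rewrite {2}/flat ltxx !subr0 ger0_norm ?flat_ge0// flat_le_sqr.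
Unshelve. all: by end_near. Qed.

Lemma Ck_flat n k : Ck n (flat k).
Proof.
elim: n k => [//|n IHn] k.
exists (fun x => flat k.+2 x - cst k%:R x * flat k.+1 x); split.
  by move=> x; exact: is_derive_flat.
by apply: CkD => //; apply: CkN; apply: CkM => //; exact: Ck_cst.
Qed.

End flat_function.

(** * Smooth steps, one-sided kernels and tensor products *)

Section steps.
Context {R : realType}.
Implicit Types (f g : R -> R) (a b s h x y : R).

Lemma flat0_gt0 y : (0 < flat 0 y :> R) = (0 < y).
Proof.
rewrite /flat; case: ifPn => [y0|]; last by rewrite ltxx.
by rewrite mulr1 expR_gt0.
Qed.

Lemma flat_le0 k y : y <= 0 -> flat k y = 0 :> R.
Proof. by rewrite /flat leNgt => /negbTE ->. Qed.

(* The transition takes place in [1, 2] rather than [0, 1], so that [kern 0 h] is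
   supported in [h, 2 * h], inside the open half-line. *)
Definition step y : R := flat 0 (y - 1) / (flat 0 (y - 1) + flat 0 (2 - y)).

Let den_gt0 y : 0 < flat 0 (y - 1) + flat 0 (2 - y) :> R.
Proof.
have [y1|y1] := ltP 1 y.
  by rewrite ltr_pwDl ?flat_ge0// flat0_gt0 subr_gt0.
by rewrite ltr_wpDl ?flat_ge0// flat0_gt0 subr_gt0 (le_lt_trans y1)// ltr1n.
Qed.

Lemma step0 y : y <= 1 -> step y = 0.
Proof. by move=> y1; rewrite /step flat_le0 ?mul0r// subr_le0. Qed.

Lemma step1 y : 2 <= y -> step y = 1.
Proof.
move=> y2; rewrite /step [flat 0 (2 - y)]flat_le0 ?subr_le0// addr0 divff//.
by rewrite gt_eqF// flat0_gt0 subr_gt0 (lt_le_trans _ y2)// ltr1n.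
Qed.

Lemma step_ge0 y : 0 <= step y.
Proof. by rewrite divr_ge0 ?flat_ge0// ltW. Qed.

Lemma step_le1 y : step y <= 1.
Proof. by rewrite ler_pdivrMr// mul1r lerDl flat_ge0. Qed.

Lemma smooth1_step : smooth1 step.
Proof.
move=> n.
have C1 : Ck n (fun y : R => flat 0 (y - 1)).
  apply: (Ck_ext _ (Ck_affine 1 (-1) (Ck_flat n 0))) => y.
  by rewrite mul1r.
have C2 : Ck n (fun y : R => flat 0 (2 - y)).
  apply: (Ck_ext _ (Ck_affine (-1) 2 (Ck_flat n 0))) => y.
  by rewrite mulN1r addrC.
apply: CkM => //; apply: CkV; last exact: CkD.
by move=> y; rewrite gt_eqF.
Qed.

(** As [flat 0] has derivative [flat 2], the quotient rule leaves a numerator with two nonnegative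
    terms. This monotonicity is what makes [kern] a probability density. *)
Lemma derive1_step_ge0 y : 0 <= derive1 step y.
Proof.
have D1 : is_derive y (1 : R) (fun y => flat 0 (y - 1)) (flat 2 (y - 1)).
  apply: (is_derive_congr (is_derive_comp_affine (is_derive_flat 0 (1 * y - 1)))) => [z|]; first by rewrite mul1r.
  by rewrite mul1r mul0r subr0 mulr1.
have D2 : is_derive y (1 : R) (fun y => flat 0 (2 - y)) (- flat 2 (2 - y)).
  apply: (is_derive_congr (is_derive_comp_affine (is_derive_flat 0 (-1 * y + 2)))) => [z|]; first by rewrite mulN1r addrC.
  by rewrite mul0r subr0 mulN1r addrC mulrN1.
have nz : flat 0 (y - 1) + flat 0 (2 - y) != 0 :> R by rewrite gt_eqF.
have D4 := is_derive_mul D1 (is_derive_inv (is_derive_add D1 D2) nz).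
have -> : derive1 step y = (flat 2 (y - 1) * flat 0 (2 - y) + flat 0 (y - 1) * flat 2 (2 - y)) /
   (flat 0 (y - 1) + flat 0 (2 - y)) ^+ 2.
  rewrite derive1E; apply: derive_val; apply: (is_derive_congr D4) => //.
  by field.
by rewrite divr_ge0 ?sqr_ge0// addr_ge0// mulr_ge0// flat_ge0.
Qed.

Definition stp s h y := step ((y - s) / h).
(** For h > 0, a probability density on [s + h, s + 2 * h]: it approximates the Dirac mass at [s]
    from the right only, as right-continuous data require. *)
Definition kern s h := (stp s h)^`().

Lemma smooth1_stp s h : smooth1 (stp s h).
Proof.
move=> n; apply: (Ck_ext _ (Ck_affine h^-1 (- s / h) (smooth1_step n))) => y.
by rewrite /stp; congr step; ring.
Qed.

Lemma smooth1_kern s h : smooth1 (kern s h).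
Proof. exact/smooth1_derive1/smooth1_stp. Qed.

Lemma stp_ge0 s h y : 0 <= stp s h y. Proof. exact: step_ge0. Qed.
Lemma stp_le1 s h y : stp s h y <= 1. Proof. exact: step_le1. Qed.

Lemma stp0 s h y : 0 < h -> y <= s + h -> stp s h y = 0.
Proof. by move=> h0 ys; rewrite /stp step0// ler_pdivrMr// mul1r lerBlDl. Qed.

Lemma stp1 s h y : 0 < h -> s + 2 * h <= y -> stp s h y = 1.
Proof. by move=> h0 ys; rewrite /stp step1// ler_pdivlMr// lerBrDl. Qed.

Lemma kern_ge0 s h y : 0 < h -> 0 <= kern s h y.
Proof.
move=> h0.
have -> : kern s h y = derive1 step ((y - s) / h) * h^-1.
  rewrite /kern derive1E; apply: derive_val.
  apply: (is_derive_congr (is_derive_comp_affine (smooth1_is_derive (h^-1 * y + - s / h) smooth1_step))) => [z|]; last congr (derive1 step _ * _).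
    by rewrite /stp; congr step; ring.
  by ring.
by rewrite mulr_ge0 ?derive1_step_ge0// invr_ge0 ltW.
Qed.

(** The interval is named because the weak equation restricts the support of the time factor. The
    case b < a is allowed and forces f = 0; it occurs for [cutoff] with reversed endpoints. *)
Definition bump_on a b f := smooth1 f /\ forall x, ~~ (a <= x <= b) -> f x = 0.

Lemma near_notin_segment a b x : ~~ (a <= x <= b) -> \forall y \near x, ~~ (a <= y <= b).
Proof.
rewrite negb_and -!ltNge => /orP[xa|bx].
  near=> y; rewrite negb_and -!ltNge; apply/orP; left.
  by near: y; exact: lt_nbhsl.
near=> y; rewrite negb_and -!ltNge; apply/orP; right.
by near: y; exact: lt_nbhsr.
Unshelve. all: by end_near. Qed.

Lemma bump_derive1 a b f : bump_on a b f -> bump_on a b f^`().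
Proof.
move=> [sf f0]; split; first exact: smooth1_derive1.
move=> x xab; rewrite derive1E; apply: derive_val.
apply: (@near_eq_is_derive _ _ _ (cst 0)).
by near=> y; rewrite f0//; near: y; exact: near_notin_segment.
Unshelve. all: by end_near. Qed.

Lemma bump_kern s h : 0 < h -> bump_on (s + h) (s + 2 * h) (kern s h).
Proof.
move=> h0; split; first exact: smooth1_kern.
move=> x; rewrite negb_and -!ltNge => /orP[xs|xs]; rewrite /kern derive1E; apply: derive_val.
  apply: (@near_eq_is_derive _ _ _ (cst 0)).
  near=> y; rewrite stp0//; apply: ltW.
  by near: y; exact: lt_nbhsl.
apply: (@near_eq_is_derive _ _ _ (cst (1 : R))).
near=> y; rewrite stp1//; apply: ltW.
by near: y; exact: lt_nbhsr.
Unshelve. all: by end_near. Qed.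

Lemma bump_stpB s t h : 0 < h -> s <= t -> bump_on (s + h) (t + 2 * h) (fun y => stp s h y - stp t h y).
Proof.
move=> h0 st; split.
  by move=> n; apply: CkD; [|apply: CkN]; exact: smooth1_stp.
move=> x; rewrite negb_and -!ltNge => /orP[xs|xs].
  by rewrite !stp0 ?subrr//; lra.
by rewrite !stp1 ?subrr//; lra.
Qed.

Lemma partials_tensor (l : seq bool) f g : smooth1 f -> smooth1 g ->
  partials l (fun t x => f t * g x) =
  fun t x => derive1n (count id l) f t * derive1n (count negb l) g x.
Proof.
move=> sf sg; elim: l => [//|[] l IHl] /=; rewrite IHl.
  apply/funext => t; apply/funext => x; rewrite /pt derive1Mr//.
  by apply: smooth1_derivable; exact: smooth1_derive1n.
apply/funext => t; apply/funext => x; rewrite /px derive1Ml//.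
by apply: smooth1_derivable; exact: smooth1_derive1n.
Qed.

Lemma smooth_tensor f g : smooth1 f -> smooth1 g -> smooth (fun t x => f t * g x).
Proof.
move=> sf sg l; rewrite partials_tensor//.
have sF := smooth1_derive1n (count id l) sf.
have sG := smooth1_derive1n (count negb l) sg.
split.
  set F := derive1n _ f in sF *; set G := derive1n _ g in sG *.
  move=> z; rewrite (_ : uncurry _ = (fun z => F z.1 * G z.2)); last first.
    by apply/funext => -[].
  apply: cvgM.
    apply: (@continuous_comp _ _ _ fst); first exact: cvg_fst.
    exact: smooth1_continuous.
  apply: (@continuous_comp _ _ _ snd); first exact: cvg_snd.
  exact: smooth1_continuous.
move=> t x; split.
  by apply: derivableM => //; exact: smooth1_derivable.
by apply: derivableM => //; exact: smooth1_derivable.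
Qed.

Lemma test_function_tensor (A : set R) a b c d f g : bump_on a b f -> bump_on c d g ->
  `[a, b] `<=` A -> test_function (A `*` setT) (fun t x => f t * g x).
Proof.
move=> [sf f0] [sg g0] abA; split; first exact: smooth_tensor.
exists (`[a, b] `*` `[c, d]); split.
- by apply: compact_setX; exact: segment_compact.
- by move=> [t x] [/= /abA].
- move=> t x /not_andP[] /= /negP; rewrite in_itv/= => H.
    by rewrite f0// mul0r.
  by rewrite g0// mulr0.
Qed.

End steps.

(** * Integrals against bumps *)

Section integrals.
Context {R : realType}.
Notation mu := (@lebesgue_measure R).
Implicit Types (f g : R -> R) (a b s h x y M : R) (D : set (measurableTypeR R)).

Lemma integrable_scale D f (c : R) : measurable D -> mu.-integrable D (EFin \o f) ->
  mu.-integrable D (EFin \o (fun x => c * f x)).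
Proof. move=> mD fi; exact: (integrableZl mD c fi). Qed.

Lemma integrable_bounded_support D f a b M : measurable D -> measurable_fun D f ->
  (forall x, D x -> `|f x| <= M) -> (forall x, D x -> ~~ (a <= x <= b) -> f x = 0) ->
  mu.-integrable D (EFin \o f).
Proof.
move=> mD mf fM f0.
have I : mu.-integrable D (EFin \o (fun x => `|M| * \1_`[a, b] x)).
  apply: (@integrableS _ _ _ _ setT) => //.
  by apply: integrable_scale => //; exact: integrable_indic_itv.
apply: le_integrable I => //; first exact/measurable_EFinP.
move=> x Dx /=; rewrite lee_fin normrM normr_id ger0_norm ?indicE//.
case: (boolP (a <= x <= b)) => xab.
  by rewrite mem_set//= mulr1 (le_trans (fM _ Dx))// ler_norm.
by rewrite f0// normr0 mulr_ge0.
Qed.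

Lemma continuous_bounded_segment f a b : continuous f ->
  exists M, forall x, a <= x <= b -> `|f x| <= M.
Proof.
move=> cf; have cW : {within `[a, b], continuous f} by exact: continuous_subspaceT.
have [M [_ HM]] := compact_bounded (continuous_compact cW (@segment_compact _ a b)).
by exists (M + 1) => x xab; apply: (HM (M + 1)); [rewrite ltrDl | exists x].
Qed.

Lemma integrable_continuous_support D f a b : measurable D -> continuous f ->
  (forall x, ~~ (a <= x <= b) -> f x = 0) -> mu.-integrable D (EFin \o f).
Proof.
move=> mD cf f0; have [M fM] := continuous_bounded_segment a b cf.
apply: (@integrable_bounded_support _ _ a b `|M|) => //.
  apply: measurable_funTS. exact: continuous_measurable_fun.
move=> x _; case: (boolP (a <= x <= b)) => xab; last by rewrite f0// normr0.
by rewrite (le_trans (fM _ xab))// ler_norm.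
by move=> x _; exact: f0.
Qed.

Lemma Rintegral_support D f a b : `[a, b] `<=` D ->
  (forall x, ~~ (a <= x <= b) -> f x = 0) ->
  \int[mu]_(x in D) f x = \int[mu]_(x in `[a, b]) f x.
Proof.
move=> abD f0; rewrite [LHS]Rintegral_mkcond [RHS]Rintegral_mkcond.
apply: eq_Rintegral => x _; rewrite !patchE.
have [xab|xab] := boolP (x \in `[a, b]%classic).
  by rewrite mem_set//; apply: abD; rewrite inE in xab.
by case: ifP => // _; apply: f0; apply/negP => H; case/negP: xab; rewrite inE.
Qed.

Lemma Rintegral_derive f g a b : a < b -> (forall x, is_derive x (1 : R) f (g x)) ->
  continuous g -> \int[mu]_(x in `[a, b]) g x = f b - f a.
Proof.
move=> ab fg cg.
have cf : continuous f.
  by move=> x; apply/differentiable_continuous/derivable1_diffP/ex_derive.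
rewrite /Rintegral (@continuous_FTC2 _ g f a b)//.
- exact: continuous_subspaceT.
- split; first by move=> x _; exact: ex_derive.
    by apply: cvg_at_right_filter; exact: cf.
  by apply: cvg_at_left_filter; exact: cf.
- by move=> x _; rewrite derive1E; exact: derive_val.
Qed.

Lemma Rintegral_derive0 f g a b : (forall x, is_derive x (1 : R) f (g x)) ->
  continuous g -> (forall x, ~~ (a <= x <= b) -> f x = 0) ->
  (forall x, ~~ (a <= x <= b) -> g x = 0) ->
  \int[mu]_x g x = 0.
Proof.
move=> fg cg f0 g0.
have [ab|ab] := leP a b; last first.
  have g00 x : g x = 0 by rewrite g0//; apply/negP; lra.
  by under eq_Rintegral do rewrite g00; rewrite Rintegral_cst// mul0r.
(* The interval is enlarged because [f] is given to vanish only strictly outside [a, b]; at the new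
   endpoints its value is 0. *)
have ab' : a - 1 < b + 1 by lra.
rewrite (@Rintegral_support setT g (a - 1) (b + 1))//.
  by rewrite (Rintegral_derive ab' fg)// !f0 ?subrr//; apply/negP; lra.
by move=> x xab; apply: g0; apply/negP; lra.
Qed.

Lemma Rintegral_by_parts_bump f f' g a b : (forall x, is_derive x (1 : R) f (f' x)) ->
  continuous f' -> bump_on a b g ->
  \int[mu]_x (f x * derive1 g x) = - \int[mu]_x (f' x * g x).
Proof.
move=> ff' cf' bg.
have [sg g0] := bg; have [sg' g'0] := bump_derive1 bg.
have cg := smooth1_continuous sg; have cg' := smooth1_continuous sg'.
have cf : continuous f.
  by move=> x; apply/differentiable_continuous/derivable1_diffP/ex_derive.
have c1 : continuous (fun x => f' x * g x).
  by move=> x; apply: cvgM; [exact: cf' | exact: cg].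
have c2 : continuous (fun x => f x * derive1 g x).
  by move=> x; apply: cvgM; [exact: cf | exact: cg'].
apply/eqP; rewrite -addr_eq0 addrC -RintegralD//.
- apply/eqP; apply: (@Rintegral_derive0 (fun x => f x * g x) _ a b).
  + by move=> x; apply: is_derive_mul => //; exact: smooth1_is_derive.
  + by move=> x; apply: cvgD; [exact: c1 | exact: c2].
  + by move=> x xab; rewrite g0// mulr0.
  + by move=> x xab; rewrite g0// g'0// !mulr0 addr0.
- apply: (@integrable_continuous_support _ _ a b) => //.
  by move=> x xab; rewrite g0// mulr0.
- apply: (@integrable_continuous_support _ _ a b) => //.
  by move=> x xab; rewrite g'0// mulr0.
Qed.

Lemma Rintegral_kern D s h : 0 < h -> `[s + h, s + 2 * h] `<=` D ->
  \int[mu]_(x in D) kern s h x = 1.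
Proof.
move=> h0 sD; have [sk k0] := bump_kern s h0.
rewrite (Rintegral_support sD)//.
have hh : s + h < s + 2 * h by lra.
have dk x : is_derive x (1 : R) (stp s h) (kern s h x).
  exact/smooth1_is_derive/smooth1_stp.
by rewrite (Rintegral_derive hh dk (smooth1_continuous sk)) stp1// stp0// subr0.
Qed.

(** The kernel is nonnegative of mass 1, so [c] is its own average and the difference is an average
    of [f - c]. *)
Lemma kern_average D f s h (c e : R) : measurable D -> 0 < h ->
  `[s + h, s + 2 * h] `<=` D ->
  mu.-integrable D (EFin \o (fun x => f x * kern s h x)) ->
  (forall x, s + h <= x <= s + 2 * h -> `|f x - c| <= e) ->
  `|\int[mu]_(x in D) (f x * kern s h x) - c| <= e.
Proof.
move=> mD h0 sD fk fc; have [sk k0] := bump_kern s h0.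
have ik : mu.-integrable D (EFin \o kern s h).
  exact: (integrable_continuous_support mD (smooth1_continuous sk) k0).
have ick (d : R) : mu.-integrable D (EFin \o (fun x => d * kern s h x)).
  exact: integrable_scale.
have -> : c = \int[mu]_(x in D) (c * kern s h x).
  by rewrite RintegralZl// Rintegral_kern// mulr1.
rewrite -RintegralB//.
have iB : mu.-integrable D (EFin \o (fun x => f x * kern s h x - c * kern s h x)).
  exact: (integrableB mD fk (ick c)).
apply: (le_trans (le_normr_Rintegral _ iB)) => //.
have -> : e = \int[mu]_(x in D) (e * kern s h x).
  by rewrite RintegralZl// Rintegral_kern// mulr1.
apply: le_Rintegral => //.
  exact: (integrable_abse iB).
move=> x Dx; case: (boolP (s + h <= x <= s + 2 * h)) => xs; last first.
  by rewrite k0// !mulr0 subrr normr0.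
rewrite -mulrBl normrM [X in _ * X]ger0_norm ?kern_ge0// ler_wpM2r ?kern_ge0//.
exact: fc.
Qed.

End integrals.

(** * Integrals depending on a parameter *)

Section parametric_integrals.
Context {R : realType}.
Notation mu := (@lebesgue_measure R).
Implicit Types (F : R -> R -> R) (f g : R -> R) (a b s h x y M : R).

Lemma continuous_uncurryl F t : continuous (uncurry F) -> continuous (F t).
Proof.
move=> cF x; have H : continuous (fun y : R => (t, y)).
  by move=> y; apply: (@cvg_pair _ _ _ _ (nbhs t) (nbhs y)) => //; exact: cvg_cst.
by apply: (@continuous_comp _ _ _ (fun y => (t, y)) (uncurry F)); [exact: H | exact: cF].
Qed.

Lemma continuous_uncurryr F x : continuous (uncurry F) -> continuous (F ^~ x).
Proof.
move=> cF t; have H : continuous (fun y : R => (y, x)).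
  by move=> y; apply: (@cvg_pair _ _ _ _ (nbhs y) (nbhs x)) => //; exact: cvg_cst.
by apply: (@continuous_comp _ _ _ (fun y => (y, x)) (uncurry F)); [exact: H | exact: cF].
Qed.

Lemma continuous_bounded_rectangle F a b c d : continuous (uncurry F) ->
  exists M, forall t x, a <= t <= b -> c <= x <= d -> `|F t x| <= M.
Proof.
move=> cF; pose K := `[a, b]%classic `*` `[c, d]%classic : set (R * R).
have cW : {within K, continuous (uncurry F)} by exact: continuous_subspaceT.
have cK : compact K by apply: compact_setX; exact: segment_compact.
have [M [_ HM]] := compact_bounded (continuous_compact cW cK).
exists (M + 1) => t x tab xcd; apply: (HM (M + 1)); first by rewrite ltrDl.
by exists (t, x).
Qed.

(** Dominated convergence: near t0 the integrand is at most M * |g|, with M a bound for [F] on the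
    rectangle [t0 - 1, t0 + 1] x [a, b]. *)
Lemma continuous_Rintegral F g a b : continuous (uncurry F) -> continuous g ->
  (forall x, ~~ (a <= x <= b) -> g x = 0) ->
  continuous (fun t => \int[mu]_x (F t x * g x)).
Proof.
move=> cF cg g0 t0.
have [M HM] := continuous_bounded_rectangle (t0 - 1) (t0 + 1) a b cF.
have cFg t : continuous (fun x => F t x * g x).
  by move=> x; apply: cvgM; [exact: continuous_uncurryl | exact: cg].
have nz (k : R -> R) x : ~~ (a <= x <= b) -> k x * g x = 0.
  by move=> xab; rewrite g0// mulr0.
apply: (@continuity_under_integral _ _ _ mu (fun t x => F t x * g x) setT measurableT
  (t0 - 1) (t0 + 1) _ _ (fun x => M * `|g x|)).
- by move=> t _; apply: (integrable_continuous_support measurableT (cFg t)) => x; exact: nz.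
- apply: aeW => x _ t _; apply: cvgM; last exact: cvg_cst.
  exact: continuous_uncurryr.
- apply: integrable_scale => //.
  apply: (@integrable_continuous_support _ _ _ a b) => //.
    by move=> x; apply: cvg_norm; exact: cg.
  by move=> x xab; rewrite g0// normr0.
- move=> t; rewrite /= in_itv/= => /andP[t1 t2]; apply: aeW => x _.
  rewrite normrM; have [xab|xab] := boolP (a <= x <= b).
    by rewrite ler_wpM2r// HM// !ltW.
  by rewrite g0// normr0 !mulr0.
- by rewrite inE/= in_itv/=; lra.
Qed.

End parametric_integrals.

(** * The du Bois-Reymond lemma *)

Section du_bois_reymond.
Context {R : realType}.
Notation mu := (@lebesgue_measure R).
Implicit Types (f g h : R -> R) (a b s x y M : R).

(** As n grows this tends pointwise to the indicator of ]p, q[. With rational endpoints the family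
    is countable, so the exceptional null sets, one for each cutoff, can be united. *)
Definition cutoff (p q : R) (n : nat) x :=
  step (n%:R * (x - p)) * step (n%:R * (q - x)).

Lemma bump_cutoff p q n : bump_on p q (cutoff p q n).
Proof.
split.
  move=> k; apply: CkM.
    apply: (Ck_ext _ (Ck_affine n%:R (- (n%:R * p)) (smooth1_step k))) => x.
    by congr step; ring.
  apply: (Ck_ext _ (Ck_affine (- n%:R) (n%:R * q) (smooth1_step k))) => x.
  by congr step; ring.
move=> x; rewrite negb_and -!ltNge /cutoff => /orP[xp|qx].
  rewrite step0 ?mul0r// (le_trans _ ler01)// mulr_ge0_le0// subr_le0 ltW//.
rewrite [step (_ * (q - x))]step0 ?mulr0//.
by rewrite (le_trans _ ler01)// mulr_ge0_le0// subr_le0 ltW.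
Qed.

Lemma cutoff_norm_le1 p q n x : `|cutoff p q n x| <= 1.
Proof.
have s0 := @step_ge0 R; have s1 := @step_le1 R.
by rewrite /cutoff ger0_norm; [apply: mulr_ile1 | apply: mulr_ge0].
Qed.

Lemma cutoff_eq1 p q n x : 2 <= n%:R * (x - p) -> 2 <= n%:R * (q - x) ->
  cutoff p q n x = 1.
Proof. by move=> ? ?; rewrite /cutoff !step1 ?mulr1. Qed.

Lemma rat_within (c e : R) : 0 < e -> exists q : rat, c < ratr q < c + e.
Proof.
move=> e0; have /rat_in_itvoo[q] : c < c + e by rewrite ltrDl.
by rewrite in_itv/=; exists q.
Qed.

(** Cutoffs whose rational endpoints tend to c and d from inside converge to 1 on ]c, d[, and |h|
    dominates the products. *)
Lemma Rintegral_itv0 h c d : c < d -> mu.-integrable `]c, d[ (EFin \o h) ->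
  (forall (p q : rat) n, c <= ratr p -> ratr q <= d ->
     \int[mu]_x (h x * cutoff (ratr p) (ratr q) n x) = 0) ->
  \int[mu]_(x in `]c, d[) h x = 0.
Proof.
move=> cd ih h0.
have n1 (n : nat) : 0 < n.+1%:R^-1 :> R by [].
have /choice[p Hp] (n : nat) : exists p : rat, c < ratr p < c + n.+1%:R^-1.
  exact: rat_within.
have /choice[q Hq] (n : nat) : exists q : rat, d - n.+1%:R^-1 < ratr q < d - n.+1%:R^-1 + n.+1%:R^-1.
  exact: rat_within.
pose phi n x := cutoff (ratr (p n)) (ratr (q n)) n.+1 x.
have mh : measurable_fun `]c, d[ h.
  by apply/measurable_EFinP; exact: (measurable_int _ ih).
have ip n : \int[mu]_(x in `]c, d[) (h x * phi n x) = 0.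
  have /andP[p1 p2] := Hp n; have /andP[q1 q2] := Hq n.
  have qd : ratr (q n) < d by rewrite (lt_le_trans q2)// subrK.
  rewrite -(h0 (p n) (q n) n.+1 (ltW p1) (ltW qd)).
  rewrite Rintegral_mkcond; apply: eq_Rintegral => x _; rewrite patchE.
  case: ifPn => // xcd; rewrite (bump_cutoff _ _ _).2 ?mulr0//.
  apply/negP => /andP[px xq]; case/negP: xcd; rewrite inE/= in_itv/=.
  by rewrite (lt_le_trans p1 px) (le_lt_trans xq qd).
have mphi n : measurable_fun setT (phi n).
  exact: (continuous_measurable_fun (smooth1_continuous (bump_cutoff _ _ _).1)).
have ep n : mu.-integrable `]c, d[ (EFin \o (fun x => h x * phi n x)).
  apply: le_integrable ih => //.
    apply/measurable_EFinP; apply: measurable_funM; first exact: mh.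
    by apply: measurable_funTS; exact: mphi.
  move=> x _ /=; rewrite lee_fin normrM -[leRHS]mulr1 ler_wpM2l//.
  exact: cutoff_norm_le1.
have := @dominated_convergence _ _ _ mu `]c, d[ (measurable_itv _)
  (fun n x => (h x * phi n x)%:E) (EFin \o h) (fun x => `|h x|%:E).
case.
- by move=> n; exact: (measurable_int _ (ep n)).
- exact: (measurable_int _ ih).
- apply: aeW => x; rewrite /= in_itv/= => /andP[cx xd].
  apply: cvg_near_cst.
  (* The plateau of the cutoff needs 2, and the distance 1/(n + 1) allowed to its endpoint costs 1
     after scaling by n + 1: hence the 3. *)
  have t1 : 0 < 3 / (x - c) by rewrite divr_gt0// subr_gt0.
  have t2 : 0 < 3 / (d - x) by rewrite divr_gt0// subr_gt0.
  near=> n.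
  have H1 : 3 / (x - c) <= n.+1%:R.
    apply: (@le_trans _ _ n%:R); last by rewrite ler_nat.
    by near: n; exact: nbhs_infty_ger.
  have H2 : 3 / (d - x) <= n.+1%:R.
    apply: (@le_trans _ _ n%:R); last by rewrite ler_nat.
    by near: n; exact: nbhs_infty_ger.
  rewrite ler_pdivrMr ?subr_gt0// in H1.
  rewrite ler_pdivrMr ?subr_gt0// in H2.
  have nn : n.+1%:R * n.+1%:R^-1 = 1 :> R by rewrite divff.
  have n0 : 0 < n.+1%:R :> R by [].
  have /andP[p1 p2] := Hp n; have /andP[q1 q2] := Hq n.
  rewrite /phi cutoff_eq1 ?mulr1//.
    have : n.+1%:R * (x - (c + n.+1%:R^-1)) <= n.+1%:R * (x - ratr (p n)).
      by rewrite ler_pM2l// lerD2l lerN2 ltW.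
    by apply: le_trans; rewrite opprD addrA mulrBr nn; lra.
  have : n.+1%:R * (d - n.+1%:R^-1 - x) <= n.+1%:R * (ratr (q n) - x).
    by rewrite ler_pM2l// lerD2r ltW.
  by apply: le_trans; rewrite addrAC mulrBr nn; lra.
- exact: (integrable_abse ih).
- apply: aeW => x n _ /=; rewrite lee_fin normrM -[leRHS]mulr1 ler_wpM2l//.
  exact: cutoff_norm_le1.
- move=> ih' _; set u := (X in X @ \oo --> _).
  have -> : u = cst 0%E.
    apply/funext => n; apply/eqP; rewrite -fine_eq0; last exact: (integrable_fin_num _ (ep n)).
    by apply/eqP; exact: ip.
  by move=> /(cvg_lim (@ereal_hausdorff R)); rewrite lim_cst// /Rintegral => <-.
Unshelve. all: by end_near. Qed.

(** By Lebesgue differentiation, h(x) is for almost every x the limit of its means over balls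
    shrinking to x. For x in U these balls end up inside U, where the means vanish. *)
Lemma du_bois_reymond (U : set R) h : open U -> locally_integrable setT h ->
  (forall (p q : rat) n, `[ratr p, ratr q] `<=` U ->
     \int[mu]_x (h x * cutoff (ratr p) (ratr q) n x) = 0) ->
  {ae mu, forall x, U x -> h x = 0}.
Proof.
move=> oU lh h0.
pose E (x : R) (n : nat) := ball x (n.+1%:R^-1 : R).
have n1 (n : nat) : 0 < n.+1%:R^-1 :> R by [].
have HE x : nicely_shrinking x (E x).
  split; first by move=> n; exact: measurable_ball.
  exists (1, fun n => PosNum (n1 n)); split => //=.
  - exact: cvg_harmonic.
  - by move=> n.
  - by move=> n; rewrite mul1e.
have := lebesgue_differentiation lh.
apply: filterS; first exact: (ae_filter_ringOfSetsType mu).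
move=> x fx Ux.
have := nice_lebesgue_differentiation HE lh fx.
set u := (X in X @ \oo --> _) => uh.
have u0 : u @ \oo --> 0%E.
  apply: cvg_near_cst.
  have /nbhs_ballP[e /= e0 xU] : nbhs x U by exact: open_nbhs_nbhs.
  near=> n.
  have ne : n.+1%:R^-1 < e.
    by near: n; exact: near_infty_natSinv_lt (PosNum e0).
  have bE : E x n = `]x - n.+1%:R^-1, x + n.+1%:R^-1[%classic.
    by rewrite /E ball_itv.
  have ih : mu.-integrable (E x n) (EFin \o h).
    case: lh => mh _ lh; rewrite bE.
    apply: (@integrableS _ _ _ mu `[x - n.+1%:R^-1, x + n.+1%:R^-1]) => //.
      exact: subset_itv_oo_cc.
    apply/integrableP; split; first by apply/measurable_EFinP; exact: measurable_funTS.
    by apply: lh => //; exact: segment_compact.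
  rewrite /u; suff -> : (\int[mu]_(y in E x n) (h y)%:E = 0)%E by rewrite mule0.
  apply/eqP; rewrite -fine_eq0; last first.
    by apply: (integrable_fin_num _ ih); exact: measurable_ball.
  apply/eqP; move: ih; rewrite bE => ih; apply: Rintegral_itv0 => //.
    by rewrite ltrD2l gtrN.
  move=> p q k xp qx; apply: h0 => y /=; rewrite in_itv/= => /andP[py yq].
  apply: xU; rewrite /ball/= ltr_distlC; apply/andP; split.
    by rewrite (lt_le_trans _ py)// (lt_le_trans _ xp)// ltrD2l ltrN2.
  by rewrite (le_lt_trans yq)// (le_lt_trans qx)// ltrD2l.
have e1 := cvg_lim (@ereal_hausdorff R) uh.
have e2 := cvg_lim (@ereal_hausdorff R) u0.
by apply: EFin_inj; rewrite -e1 e2.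
Unshelve. all: by end_near. Qed.

End du_bois_reymond.

(** * Differentiation of the power series xi *)

Section power_series.
Context {R : realType}.
Implicit Types (c : nat -> R) (K r x t : R).

(** Convergence is asked only strictly inside the radius; this open condition survives termwise
    differentiation. *)
Definition summable_within c r := (forall n, 0 <= c n) /\
  forall K, 0 < K < r -> cvgn (pseries c K).

(** Comparison with the series at a larger radius L: by Bernoulli's inequality (L / K)^n grows at
    least linearly and absorbs the factor n + 1 that differentiation produces. *)
Lemma summable_within_diffs c r :
  summable_within c r -> summable_within (pseries_diffs c) r.
Proof.
move=> [c0 cK]; split; first by move=> n; rewrite mulr_ge0.
move=> K /andP[K0 Kr]; pose L := (K + r) / 2.
have KL : K < L by rewrite /L; lra.
have L0 : 0 < L by lra.
have HL : cvgn (pseries c L) by apply: cK; rewrite /L; lra.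
clearbody L.
(* The bound L / K - 1 serves Bernoulli's inequality; the bound 1 gives (n + 1) * m <= 1 + n * m. *)
pose m := Num.min 1 (L / K - 1).
have m0 : 0 < m by rewrite lt_min ltr01 subr_gt0 ltr_pdivlMr// mul1r.
have m1 : m <= 1 by rewrite ge_min lexx.
have mLK : 1 + m <= L / K by rewrite addrC -lerBrDr ge_min lexx orbT.
have LK0 : 0 <= L / K by rewrite divr_ge0// ltW.
have bern (n : nat) : 1 + n%:R * m <= (L / K) ^+ n.
  elim: n => [|n IHn]; first by rewrite expr0 mul0r addr0.
  rewrite exprSr.
  apply: (@le_trans _ _ ((1 + n%:R * m) * (1 + m))).
    rewrite -natr1; have : 0 <= n%:R * m * m by rewrite !mulr_ge0// ltW.
    by lra.
  by rewrite ler_pM// ?addr_ge0// ?mulr_ge0// ltW.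
have bound (n : nat) : pseries_diffs c n * K ^+ n <= (m * L)^-1 * (c n.+1 * L ^+ n.+1).
  rewrite /pseries_diffs ler_pdivlMl ?mulr_gt0//.
  have H : n.+1%:R * m <= (L / K) ^+ n.
    by apply: le_trans (bern n); rewrite -natr1 mulrDl mul1r addrC lerD2r.
  have -> : c n.+1 * L ^+ n.+1 = (L / K) ^+ n * (L * c n.+1 * K ^+ n).
    have K1 : K != 0 by rewrite gt_eqF.
    have : K ^+ n != 0 by rewrite expf_neq0// gt_eqF.
    by rewrite exprMn exprVn exprSr; move: (K ^+ n) (L ^+ n) => k l k0; field.
  have -> : m * L * (n.+1%:R * c n.+1 * K ^+ n) = n.+1%:R * m * (L * c n.+1 * K ^+ n).
    by ring.
  by rewrite ler_wpM2r// !mulr_ge0// ?exprn_ge0// ltW.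
apply: (@series_le_cvg _ _ (fun n => (m * L)^-1 * (c n.+1 * L ^+ n.+1))).
- by move=> n; rewrite !mulr_ge0// ?exprn_ge0// ltW.
- by move=> n; rewrite !mulr_ge0// ?invr_ge0 ?exprn_ge0 ?mulr_ge0// ltW.
- exact: bound.
suff H : cvgn (series (fun n => c n.+1 * L ^+ n.+1)).
  by have := @is_cvg_seriesZ _ _ (m * L)^-1 H.
have -> : series (fun n => c n.+1 * L ^+ n.+1) = fun n => series (fun n => c n * L ^+ n) n.+1 - c 0%N.
  apply/funext => n; rewrite /series/= big_nat_recl//= expr0 mulr1.
  by rewrite addrAC subrr add0r.
apply: is_cvgB; last exact: is_cvg_cst.
apply/cvg_ex; exists (limn (pseries c L)).
by rewrite (cvg_shiftS (pseries c L)).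
Qed.

Lemma is_derive_pseries c r x : summable_within c r -> `|x| < r ->
  is_derive x (1 : R) (fun y => limn (pseries c y)) (limn (pseries (pseries_diffs c) x)).
Proof.
move=> sc xr; pose K := (`|x| + r) / 2.
have x0 := normr_ge0 x.
have K0 : 0 < K by rewrite /K; lra.
have Kr : 0 < K < r by rewrite K0 /K; lra.
apply: (@pseries_snd_diffs _ c K) => //.
- exact: sc.2.
- exact: (summable_within_diffs sc).2.
- exact: (summable_within_diffs (summable_within_diffs sc)).2.
- by rewrite (gtr0_norm K0) /K; lra.
Qed.

Lemma pseries_derive1 c r x : summable_within c r -> `|x| < r ->
  \forall y \near x, derive1 (fun z => limn (pseries c z)) y = limn (pseries (pseries_diffs c) y).
Proof.
move=> sc xr; near=> y.
have yr : `|y| < r.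
  by near: y; apply: (@cvgr_norm_lt _ _ _ _ _ id x); [exact: cvg_id | exact: xr].
by rewrite derive1E; apply: derive_val; exact: is_derive_pseries yr.
Unshelve. all: by end_near. Qed.

(** On [0, 1] one has |t| < 1 + eps, so [xi] can be differentiated termwise in a two-sided
    neighbourhood of t, endpoints included. The sign comes from the nonnegative coefficients. *)
Lemma xi_second_derivative (beta : nat -> R) (eps : R) : 0 < eps ->
  (\sum_(1 <= p <oo) (beta p ^+ 2 * (1 + eps) ^+ p)%:E < +oo)%E ->
  forall t, 0 <= t <= 1 ->
    0 <= derive1n 2 (xi beta) t /\ {for t, continuous (derive1n 2 (xi beta))}.
Proof.
move=> eps0 hs.
pose c p := if p is 0 then 0 else beta p ^+ 2.
have c0 n : 0 <= c n by case: n => // n; exact: sqr_ge0.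
have xiE : xi beta = fun t => limn (pseries c t).
  apply/funext => t; rewrite /xi; congr (limn _); apply/funext => n.
  rewrite /pseries /series/=; case: n => [|n]; first by rewrite !big_geq.
  rewrite [RHS]big_ltn//= mul0r add0r; apply: eq_big_nat => i /andP[i0 _].
  by case: i i0.
have sc : summable_within c (1 + eps).
  split => // K /andP[K0 Ke].
  apply: (@is_cvg_pseries_inside _ c (1 + eps)); last first.
    by rewrite !gtr0_norm// addr_gt0.
  apply: nondecreasing_is_cvgn.
    by apply: nondecreasing_series => n _ _; rewrite mulr_ge0// exprn_ge0// addr_ge0// ltW.
  set S := (\sum_(1 <= p <oo) _)%E in hs.
  exists (fine S) => _ [n _ <-]; rewrite -lee_fin fineK; last first.
    rewrite ge0_fin_numE//; apply: nneseries_ge0 => p _ _.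
    by rewrite lee_fin mulr_ge0 ?sqr_ge0// exprn_ge0// addr_ge0// ltW.
  apply: (@le_trans _ _ (\sum_(1 <= p < n) (beta p ^+ 2 * (1 + eps) ^+ p)%:E)%E).
    rewrite [X in (_ <= X)%E]sumEFin lee_fin /pseries /series/=.
    case: n => [|n]; first by rewrite !big_geq.
    rewrite big_ltn//= mul0r add0r le_eqVlt; apply/orP; left; apply/eqP.
    by apply: eq_big_nat => i /andP[i0 _]; case: i i0.
  apply: nneseries_lim_ge => p _ _.
  by rewrite lee_fin mulr_ge0 ?sqr_ge0// exprn_ge0// addr_ge0// ltW.
have sd := summable_within_diffs sc; have sdd := summable_within_diffs sd.
move=> t /andP[t0 t1].
have tr : `|t| < 1 + eps by rewrite ger0_norm//; lra.
have d2 : \forall y \near t, derive1n 2 (xi beta) y =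
    limn (pseries (pseries_diffs (pseries_diffs c)) y).
  near=> y.
  have yr : `|y| < 1 + eps.
    by near: y; apply: (@cvgr_norm_lt _ _ _ _ _ id t); [exact: cvg_id | exact: tr].
  rewrite derive1nS derive1n1 xiE derive1E.
  rewrite (near_eq_derive _ (pseries_derive1 sc yr)).
  by apply: derive_val; exact: is_derive_pseries yr.
split.
  rewrite (nbhs_singleton d2); apply: limr_ge.
    apply: (@is_cvg_pseries_inside _ _ (1 + eps / 2)).
      by apply: sdd.2; lra.
    by rewrite !ger0_norm//; lra.
  apply: nearW => n; apply: sumr_ge0 => i _.
  by rewrite mulr_ge0 ?exprn_ge0//; exact: sdd.1.
rewrite /prop_for /continuous_at (nbhs_singleton d2).
have cD : {for t, continuous (fun y => limn (pseries (pseries_diffs (pseries_diffs c)) y))}.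
  apply/differentiable_continuous/derivable1_diffP.
  exact: (@ex_derive _ _ _ _ _ _ _ (is_derive_pseries sdd tr)).
apply: cvg_trans cD; apply: near_eq_cvg.
by move: d2; apply: filterS => y ->.
Unshelve. all: by end_near. Qed.

End power_series.

(** * The maximum principle *)

Section maximum_principle.
Context {R : realType}.
Implicit Types (f g : R -> R) (a b s h x y t M : R).

Definition tanh x : R := (expR x - expR (- x)) / (expR x + expR (- x)).

Let D0 x : 0 < expR x + expR (- x) :> R.
Proof. by rewrite addr_gt0 ?expR_gt0. Qed.

Let dN x : is_derive x (1 : R) (fun y => expR (- y)) (- expR (- x)).
Proof.
apply: (is_derive_congr (is_derive_comp_affine (is_derive_expR (-1 * x + 0)))) => [y|].
  by rewrite mulN1r addr0.
by rewrite mulN1r addr0 mulrN1.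
Qed.

Lemma is_derive_lncosh x : is_derive x (1 : R) (fun y => ln (cosh y)) (tanh x).
Proof.
have Dc : is_derive x (1 : R) (fun y => cosh y) ((expR x - expR (- x)) / 2).
  apply: (is_derive_congr (is_derive_mul (is_derive_add (is_derive_expR x) (dN x))
    (is_derive_cst (2 : R)^-1 x 1))) => //.
  by rewrite mulr0 addr0.
have c0 : 0 < cosh x by rewrite divr_gt0.
apply: (is_derive_congr (@is_derive_comp _ (@ln R) _ x _ _ (is_derive1_ln c0) Dc)) => //.
by rewrite /cosh /tanh; field; rewrite gt_eqF.
Qed.

Lemma is_derive_tanh x : is_derive x (1 : R) tanh (1 - tanh x ^+ 2).
Proof.
have nz : expR x + expR (- x) != 0 by rewrite gt_eqF.
apply: (is_derive_congr (is_derive_mul (is_derive_sub (is_derive_expR x) (dN x))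
  (is_derive_inv (is_derive_add (is_derive_expR x) (dN x)) nz))) => //.
by rewrite /tanh; field.
Qed.

Lemma tanh2_lt1 x : tanh x ^+ 2 < 1.
Proof.
rewrite /tanh expr_div_n ltr_pdivrMr ?exprn_gt0// mul1r -subr_gt0.
rewrite (_ : _ - _ = 4 * (expR x * expR (- x))); last by ring.
by rewrite expRxMexpNx_1.
Qed.

Lemma norm_tanh_lt1 x : `|tanh x| < 1.
Proof. by rewrite -(@ltr_pXn2r _ 2)// ?nnegrE// real_normK ?num_real// expr1n tanh2_lt1. Qed.

(** Linear growth is what makes log cosh a penalty at infinity. The constant 1 stands for log 2 <=
    1. *)
Lemma lncosh_ge x : `|x| - 1 <= ln (cosh x).
Proof.
have H : expR `|x| / 2 <= cosh x.
  rewrite /cosh ler_pM2r//; have := expR_gt0 x; have := expR_gt0 (- x).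
  by case: (ger0P x) => _; lra.
have p : 0 < expR `|x| / 2 by rewrite divr_gt0// expR_gt0.
apply: (@le_trans _ _ (ln (expR `|x| / 2))).
  rewrite ln_div ?posrE ?expR_gt0// expRK lerD2l lerN2.
  by have := @le_ln1Dx R 1; rewrite -natr1; apply; lra.
by rewrite ler_ln ?posrE//; exact: lt_le_trans H.
Qed.

Lemma lncosh_ge0 x : 0 <= ln (cosh x).
Proof.
apply: ln_ge0; rewrite /cosh.
have := expR_ge1Dx x; have := expR_ge1Dx (- x); lra.
Qed.

(** If d > 0, then f' > 0 just to the right of x, and the mean value theorem yields a value larger
    than f x. *)
Lemma second_derivative_at_max f f' x (d : R) :
  (forall y, is_derive y (1 : R) f (f' y)) -> is_derive x (1 : R) f' d ->
  (forall y, f y <= f x) -> f' x = 0 /\ d <= 0.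
Proof.
move=> ff' f'd fx.
have f'x : f' x = 0.
  have [] := @derive1_at_max _ f (x - 1) (x + 1) x _ _ _ _ => //.
  - by lra.
  - by rewrite in_itv/=; lra.
  - by move=> _ <-; apply/esym; exact: derive_val.
split=> //; rewrite leNgt; apply/negP => d0.
have fd : h^-1 *: (f' (h *: 1 + x) - f' x) @[h --> 0^'] --> d.
  by case: f'd => ex <-.
have [e /= e0 He] := cvgr_gt d fd 0 d0.
have e2 : 0 < e / 2 by rewrite divr_gt0.
have f'pos y : x < y < x + e -> 0 < f' y.
  move=> /andP[xy ye].
  have yx0 : 0 < y - x by rewrite subr_gt0.
  have := He (y - x); rewrite /ball/= sub0r normrN gtr0_norm//.
  rewrite [(y - x) *: 1]mulr1 subrK f'x subr0 => /(_ _ _).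
  rewrite ltrBlDl => /(_ ye); rewrite gt_eqF// => /(_ isT).
  by rewrite /GRing.scale/= pmulr_rgt0// invr_gt0.
have xe : x < x + e / 2 by rewrite ltrDl.
have cff : {within `[x, x + e / 2], continuous f}.
  apply: continuous_subspaceT => y.
  by apply/differentiable_continuous/derivable1_diffP; exact: (@ex_derive _ _ _ _ _ _ _ (ff' y)).
have [c] := @MVT _ f f' x (x + e / 2) xe (fun y _ => ff' y) cff.
rewrite in_itv/= => /andP[xc ce] fE.
have := fx (x + e / 2); rewrite -subr_le0 fE addrAC subrr add0r leNgt => /negP; apply.
by rewrite mulr_gt0// f'pos// xc/= (lt_trans ce)// ltrD2l; lra.
Qed.

Definition right_derive f t d := h^-1 * (f (t + h) - f t) @[h --> 0^'+] --> (d : R).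

(* At a positive maximum of [f t x - de * (ln (cosh x) + K * (1 - t))] the right
   time derivative would be positive. *)
Lemma maximum_principle (f : R -> R -> R) (S M C : R) :
  0 <= S -> 0 <= M -> continuous (uncurry f) ->
  (forall t x, 0 <= t <= 1 -> f t x <= C) -> (forall x, f 1 x <= 0) ->
  (forall t x, 0 <= t < 1 -> exists (d : R) (f' : R -> R) (w A B : R),
     [/\ right_derive (f ^~ x) t d,
         forall y, is_derive y (1 : R) (f t) (f' y),
         is_derive x (1 : R) f' w,
         0 <= A <= S /\ `|B| <= M &
         0 <= d + A * (w + B * f' x)]) ->
  forall t x, 0 <= t <= 1 -> f t x <= 0.
Proof.
move=> S0 M0 cf fC f1 fd t1 x1 t1I; rewrite leNgt; apply/negP => ft1.
(* At the maximum the diffusion and drift terms contribute at most S * (1 + M) * de and the time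
   derivative at most - de * K; the extra 1 makes the sum negative. *)
pose K := S * (1 + M) + 1.
have K0 : 0 < K by rewrite /K ltr_wpDl// mulr_ge0// addr_ge0.
pose T x : R := ln (cosh x).
have T0 x : 0 <= T x by exact: lncosh_ge0.
(* [W] exceeds the penalty [T x1 + K * (1 - t1)], so that with de = f t1 x1 / W the penalised
   function is still positive at (t1, x1). *)
pose W := T x1 + K + 1.
have W0 : 0 < W by rewrite /W; have := T0 x1; lra.
pose de := f t1 x1 / W.
have de0 : 0 < de by rewrite divr_gt0.
pose h t x := f t x - de * (T x + K * (1 - t)).
have h1 : 0 < h t1 x1.
  rewrite /h subr_gt0 /de mulrAC ltr_pdivrMr// ltr_pM2l// /W.
  have : K * (1 - t1) <= K * 1 by rewrite ler_pM2l//; lra.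
  by lra.
(* For |x| >= X the penalty outweighs the bound [C], so the maximum over the strip is attained in a
   compact rectangle, which contains (t1, x1). *)
pose X := Num.max `|x1| (`|C| / de + 1).
have hX t x : 0 <= t <= 1 -> X <= `|x| -> h t x <= 0.
  move=> tI xX.
  have Kt : 0 <= K * (1 - t) by apply: mulr_ge0; [exact: ltW | lra].
  have CX : `|C| / de + 1 <= `|x| by apply: le_trans xX; rewrite le_max lexx orbT.
  have Cd : `|C| <= de * T x.
    rewrite -ler_pdivrMl// mulrC; have := lncosh_ge x; rewrite -/(T x); lra.
  have dK : 0 <= de * (K * (1 - t)) by rewrite mulr_ge0// ltW.
  by rewrite /h mulrDr; have := fC t x tI; have := ler_norm C; lra.
have X0 : 0 <= X by rewrite le_max normr_ge0.
pose Q := `[0 : R, 1]%classic `*` `[- X, X]%classic : set (R * R).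
have cQ : compact Q by apply: compact_setX; exact: segment_compact.
have ch : continuous (uncurry h).
  move=> z.
  have -> : uncurry h = (fun z => uncurry f z - de * (T z.2 + K * (1 - z.1))).
    by apply/funext => -[].
  apply: cvgB; first exact: cf.
  apply: cvgMr; apply: cvgD.
    apply: (@continuous_comp _ _ _ snd T); first exact: cvg_snd.
    apply/differentiable_continuous/derivable1_diffP.
    exact: (@ex_derive _ _ _ _ _ _ _ (is_derive_lncosh _)).
  by apply: cvgMr; apply: cvgB; [exact: cvg_cst | exact: cvg_fst].
have Qne : Q !=set0.
  by exists (0, 0); split; rewrite /= in_itv/= ?lexx ?ler01// oppr_le0 X0.
have [[t0 x0] /= [z0Q z0max]] :=
  @compact_EVT_max _ _ (uncurry h) Q Qne cQ (continuous_subspaceT ch).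
have t0I : 0 <= t0 <= 1 by move: z0Q; rewrite inE => -[] /=; rewrite in_itv.
have hmax t x : 0 <= t <= 1 -> h t x <= h t0 x0.
  move=> tI; have h10 : h t1 x1 <= h t0 x0.
    apply: (z0max (t1, x1)); rewrite inE; split; rewrite /= in_itv//=.
    by rewrite -ler_norml le_max lexx.
  have [xX|Xx] := leP `|x| X; last first.
    by apply: (le_trans (hX t x tI (ltW Xx))); apply: le_trans h10; exact: ltW.
  by apply: (z0max (t, x)); rewrite inE; split; rewrite /= in_itv//= -ler_norml.
have h0 : 0 < h t0 x0 by apply: lt_le_trans h1 _; exact: hmax.
have t01 : 0 <= t0 < 1.
  rewrite lt_neqAle; have /andP[-> ->] := t0I; rewrite andbT/=.
  apply/eqP => t0E; move: h0; rewrite /h t0E subrr mulr0 addr0 ltNge => /negP; apply.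
  have dT : 0 <= de * T x0 by rewrite mulr_ge0// ltW.
  by have := f1 x0; lra.
have [d [f' [w [A [B [rd ff' f'w [/andP[A0 AS] BM] dAB]]]]]] := fd t0 x0 t01.
have dh y : is_derive y (1 : R) (h t0) (f' y - de * tanh y).
  have D2 := is_derive_mul (is_derive_cst de y 1)
    (is_derive_add (is_derive_lncosh y) (is_derive_cst (K * (1 - t0)) y 1)).
  apply: (is_derive_congr (is_derive_sub (ff' y) D2)) => //.
  by rewrite mul0r add0r addr0.
have ddh : is_derive x0 (1 : R) (fun y => f' y - de * tanh y) (w - de * (1 - tanh x0 ^+ 2)).
  apply: (is_derive_congr (is_derive_sub f'w (is_derive_mul (is_derive_cst de x0 1) (is_derive_tanh x0)))) => //.
  by rewrite mul0r add0r.
have [f'0 w0] := second_derivative_at_max dh ddh (fun y => hmax t0 y t0I).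
(* Only the later times t0 + s are compared with t0, so a right derivative suffices and t0 = 0 is no
   exception. *)
have dK : d <= - (de * K).
  have <- := cvg_lim (@Rhausdorff R) rd.
  apply: limr_le; first by apply/cvg_ex; exists d.
  near=> s.
  have s0 : 0 < s by [].
  have s1 : s < 1 - t0 by near: s; apply: nbhs_right_lt; lra.
  have ts : 0 <= t0 + s <= 1 by lra.
  have := hmax (t0 + s) x0 ts; rewrite /h => H.
  rewrite -subr_ge0 -(pmulr_rge0 _ s0) mulrDr !mulrN mulVKf ?gt_eqF//.
  clearbody T K; clear -H; lra.
have f'E : f' x0 = de * tanh x0 by apply/eqP; rewrite -subr_eq0 f'0.
have wle : w <= de.
  have : 0 <= de * tanh x0 ^+ 2 by rewrite mulr_ge0 ?sqr_ge0// ltW.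
  by move: w0; rewrite mulrBr mulr1; lra.
have Bf : B * f' x0 <= M * de.
  apply: le_trans (ler_norm _) _; rewrite normrM ler_pM//.
  rewrite f'E normrM gtr0_norm// -[leRHS]mulr1 ler_pM2l//.
  exact/ltW/norm_tanh_lt1.
have AS' : A * (w + B * f' x0) <= S * (de + M * de).
  apply: (@le_trans _ _ (A * (de + M * de))); first by rewrite ler_wpM2l// (lerD wle Bf).
  have dM : 0 <= M * de by rewrite mulr_ge0// ltW.
  by rewrite ler_wpM2r// addr_ge0// ltW.
have KE : de * K = S * (de + M * de) + de by rewrite /K; ring.
by lra.
Unshelve. all: by end_near. Qed.

End maximum_principle.

(** * Almost everywhere equality *)

Section almost_everywhere.
Context d (T : measurableType d) (R : realType) (mu : {measure set T -> \bar R}).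
Implicit Types (f g : T -> \bar R) (D N : set T).
Local Open Scope ereal_scope.

Import HBNNSimple.

Lemma ae_imply (P Q : T -> Prop) : (forall x, P x -> Q x) ->
  {ae mu, forall x, P x} -> {ae mu, forall x, Q x}.
Proof.
move=> PQ [N [mN N0 PN]]; exists N; split => //.
by apply: subset_trans PN => x /= nQ Px; apply/nQ/PQ.
Qed.

Lemma ae_imply2 (P Q S : T -> Prop) : (forall x, P x -> Q x -> S x) ->
  {ae mu, forall x, P x} -> {ae mu, forall x, Q x} -> {ae mu, forall x, S x}.
Proof.
move=> PQS [N [mN N0 PN]] [M [mM M0 QM]]; exists (N `|` M); split.
- exact: measurableU.
- by apply: null_set_setU.
- move=> x /= nS; apply: contrapT => /not_orP[nN nM]; apply: nS.
  by apply: PQS; apply: contrapT => H; [apply: nN; exact: PN | apply: nM; exact: QM].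
Qed.

Lemma ae_forall_countable (I : countType) (P : I -> T -> Prop) :
  (forall i, {ae mu, forall x, P i x}) -> {ae mu, forall x, forall i, P i x}.
Proof.
move=> aeP; have : {ae mu, forall x, forall n, forall i, unpickle n = Some i -> P i x}.
  apply: ae_foralln => n; case E : (unpickle n : option I) => [i|]; last first.
    by exists set0; split => // x /= [].
  by apply: ae_imply (aeP i) => x Px j [<-].
by apply: ae_imply => x H i; apply: (H (pickle i)); rewrite pickleK.
Qed.

(* A simple function below [f] can be cut off on the null set [N], so [f] and [g]
   may fail to be measurable. *)
Lemma ge0_ae_le_integral f g N : measurable N -> mu N = 0 ->
  (forall x, 0 <= f x) -> (forall x, 0 <= g x) ->
  (forall x, ~ N x -> f x <= g x) ->
  \int[mu]_x f x <= \int[mu]_x g x.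
Proof.
move=> mN N0 f0 g0 fg; rewrite !ge0_integralTE//.
apply: ge_ereal_sup => _ [h /= hf <-].
have mNC : measurable (~` N) by exact: measurableC.
have hE x : proj_nnsfun h mNC x = (h \_ (~` N)) x by rewrite mrestrict.
apply: (@le_trans _ _ (sintegral mu (proj_nnsfun h mNC))); last first.
  apply: ereal_sup_ubound; exists (proj_nnsfun h mNC) => // x.
  apply: (@le_trans _ _ ((h \_ (~` N)) x)%:E); first by rewrite -hE.
  rewrite patchE; case: ifPn => [xN|_]; last exact: g0.
  by rewrite (le_trans (hf x))// fg//; rewrite inE in xN.
have mh : measurable_fun setT (EFin \o h) by exact/measurable_EFinP.
have mp : measurable_fun setT (EFin \o proj_nnsfun h mNC) by exact/measurable_EFinP.
have := @ae_eq_integral _ _ _ mu setT _ _ measurableT mh mp.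
rewrite (integral_nnsfun mu measurableT h) (integral_nnsfun mu measurableT (proj_nnsfun h mNC)).
rewrite !patch_setT => ->//.
exists N; split => // x /= /not_implyP[_]; apply: contra_notP => xN.
by have := hE x; rewrite patchE mem_set//= => ->.
Qed.

Lemma ge0_eq_ae_integral f g N : measurable N -> mu N = 0 ->
  (forall x, 0 <= f x) -> (forall x, 0 <= g x) ->
  (forall x, ~ N x -> f x = g x) ->
  \int[mu]_x f x = \int[mu]_x g x.
Proof.
move=> mN N0 f0 g0 fg; apply/eqP; rewrite eq_le.
by rewrite !(@ge0_ae_le_integral _ _ N)//; move=> x /fg ->.
Qed.

(** Positive and negative parts are compared separately. No measurability is assumed, so v can be
    exchanged for u_x inside iterated integrals without further checks. *)
Lemma eq_ae_integral D f g : {ae mu, forall x, D x -> f x = g x} ->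
  \int[mu]_(x in D) f x = \int[mu]_(x in D) g x.
Proof.
move=> [N [mN N0 fgN]].
have fg x : ~ N x -> (f \_ D) x = (g \_ D) x.
  move=> Nx; rewrite !patchE; case: ifPn => // xD.
  apply: contrapT => H; apply: Nx; apply: fgN => /= /(_ _)/H; apply.
  by rewrite inE in xD.
rewrite integral_mkcond [RHS]integral_mkcond integralE [RHS]integralE.
congr (_ - _); apply: (@ge0_eq_ae_integral _ _ N) => // x Nx.
  by rewrite unlock fg.
by rewrite unlock fg.
Qed.

Lemma eq_ae_Rintegral D (f g : T -> R) : {ae mu, forall x, D x -> f x = g x} ->
  Rintegral mu D f = Rintegral mu D g.
Proof.
move=> fg; rewrite /Rintegral; congr fine; apply: eq_ae_integral.
by apply: ae_imply fg => x fg Dx; rewrite fg.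
Qed.

End almost_everywhere.

(** * Sections of null sets and local integrability *)

Section sections_and_local_integrability.
Context {R : realType}.
Notation mu := (@lebesgue_measure R).

(** The measures of the sections of a null set are nonnegative and integrate to 0, hence vanish for
    almost every t. *)
Lemma ae_product_sections (P : R * R -> Prop) : {ae (mu \x mu)%E, forall z, P z} ->
  {ae mu, forall t, {ae mu, forall x, P (t, x)}}.
Proof.
move=> [N [mN N0 PN]].
have : ae_eq mu setT (mu \o xsection N) (cst 0%E).
  apply/ae_eq_integral_abs => //; first exact: measurable_fun_xsection.
  rewrite -[RHS]N0 /product_measure1; apply: eq_integral => x _.
  by rewrite gee0_abs.
apply: ae_imply => t /(_ I) /= Nt.
exists (xsection N t); split => //; first exact: measurable_xsection.
by move=> x /= Px; rewrite /xsection/= inE; apply: PN.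
Qed.

Lemma ae_bounded_locally_integrable (f : R -> R) (M : R) :
  measurable_fun setT f -> {ae mu, forall x, `|f x| <= M} ->
  locally_integrable setT f.
Proof.
move=> mf fM; split => //; first exact: openT.
move=> K _ cK; have mK := compact_measurable cK.
apply: (@le_lt_trans _ _ (\int[mu]_(x in K) (cst `|M|%:E x))%E).
  apply: ae_ge0_le_integral => //.
  - apply/measurable_EFinP; apply: measurableT_comp => //.
    by apply: measurable_funTS; exact: mf.
  - by move=> x _; rewrite lee_fin.
  - by apply: ae_imply fM => x fM _; rewrite lee_fin (le_trans fM)// ler_norm.
by rewrite integral_cst// lte_mul_pinfty// compact_finite_measure.
Qed.

End sections_and_local_integrability.

(** * Identification of the weak derivative *)

Section weak_derivative.
Context {R : realType}.
Notation mu := (@lebesgue_measure R).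
Implicit Types (F : R -> R -> R) (f g a b : R -> R) (t x : R).

(** Pairing with [b] in space leaves a function of time alone, so the weak equation becomes a family
    of identities in one variable. *)
Definition slice F b t : R := \int[mu]_x (F t x * b x).

Lemma measurable_slice_integral (f : R * R -> R) : measurable_fun setT f ->
  measurable_fun setT (fun t => \int[mu]_x f (t, x)).
Proof.
move=> mf; have mEf : measurable_fun setT (EFin \o f) by exact/measurable_EFinP.
apply: measurableT_comp => //.
have -> : (fun t => \int[mu]_x (f (t, x))%:E)%E =
   ((fun t => \int[mu]_x ((EFin \o f)^\+ (t, x)))%E \- (fun t => \int[mu]_x ((EFin \o f)^\- (t, x)))%E)%E.
  apply/funext => t; rewrite integralE.
  by congr (_ - _)%E; apply: eq_integral => x _; rewrite ?unlock.
apply: emeasurable_funB.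
  apply: (@measurable_fun_fubini_tonelli_F _ _ _ _ R mu (EFin \o f)^\+%E) => //.
  exact: measurable_funepos.
apply: (@measurable_fun_fubini_tonelli_F _ _ _ _ R mu (EFin \o f)^\-%E) => //.
exact: measurable_funeneg.
Qed.

Lemma slice_continuous F b (c d : R) : continuous (uncurry F) -> bump_on c d b ->
  continuous (slice F b).
Proof.
move=> cF [sb b0]; apply: (@continuous_Rintegral _ F b c d) => //.
exact: smooth1_continuous.
Qed.

Lemma integrable_slice F b (c d : R) t : continuous (uncurry F) -> bump_on c d b ->
  mu.-integrable setT (EFin \o (fun x => F t x * b x)).
Proof.
move=> cF [sb b0]; apply: (@integrable_continuous_support _ _ _ c d) => //.
  move=> x; apply: cvgM; first exact: continuous_uncurryl.
  exact: smooth1_continuous.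
by move=> x xcd; rewrite b0// mulr0.
Qed.

Lemma slice_by_parts F G b (c d : R) t : continuous (uncurry G) ->
  (forall y, is_derive y (1 : R) (F t) (G t y)) -> bump_on c d b ->
  slice F (derive1 b) t = - slice G b t.
Proof.
by move=> cG FG bb; apply: (Rintegral_by_parts_bump FG _ bb); exact: continuous_uncurryl.
Qed.

(* [v] need not be measurable off the strip, hence the restriction. *)
Lemma measurable_slice_strip (v : R -> R -> R) b :
  measurable_fun (`]0, 1[ `*` setT : set (R * R)) (uncurry v) -> continuous b ->
  measurable_fun (`]0, 1[ : set R) (slice v b).
Proof.
move=> mv cb.
pose D := `]0 : R, 1[%classic `*` setT : set (R * R).
have mD : measurable D by exact: measurableX.
have mvD : measurable_fun setT (uncurry v \_ D) by apply: (measurable_restrictT _ mD).1.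
have mb : measurable_fun setT (fun z : R * R => b z.2).
  by apply: measurableT_comp => //; exact: continuous_measurable_fun.
have mvb : measurable_fun setT (fun z => (uncurry v \_ D) z * b z.2).
  exact: measurable_funM.
have := measurable_slice_integral mvb.
move=> /(@measurable_funTS _ _ _ _ (`]0, 1[%classic : set R)).
apply: eq_measurable_fun => t t01.
by apply: eq_Rintegral => x _; rewrite patchE mem_set//; split=> //; rewrite inE in t01.
Qed.

Lemma measurable_strip_slice (v : R -> R -> R) t : 0 < t < 1 ->
  measurable_fun (`]0, 1[ `*` setT : set (R * R)) (uncurry v) ->
  measurable_fun setT (v t).
Proof.
move=> t01 mv.
pose D := `]0 : R, 1[%classic `*` setT : set (R * R).
have mD : measurable D by exact: measurableX.
have mvD : measurable_fun setT (uncurry v \_ D) by apply: (measurable_restrictT _ mD).1.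
have := measurableT_comp mvD (pair1_measurable t).
apply: eq_measurable_fun => x _ /=; rewrite patchE mem_set//.
Qed.

End weak_derivative.

(** * Uniqueness of the weak space derivative *)

Section weak_derivative_unique.
Context {R : realType}.
Notation mu := (@lebesgue_measure R).
Implicit Types (F : R -> R -> R) (f g a b : R -> R) (t x : R) (D : set (measurableTypeR R)).

Lemma integrable_ae_bounded_mul D f g (M : R) : measurable D ->
  measurable_fun D f -> {ae mu, forall x, D x -> `|f x| <= M} ->
  mu.-integrable D (EFin \o g) ->
  mu.-integrable D (EFin \o (fun x => f x * g x)).
Proof.
move=> mD mf fM ig; have := integrable_abse (integrable_scale `|M| mD ig).
move=> /integrableP[mMg Mgoo]; apply/integrableP; split.
  apply/measurable_EFinP/measurable_funM => //.
  by apply/measurable_EFinP; exact: (measurable_int _ ig).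
apply: le_lt_trans Mgoo; apply: ae_ge0_le_integral => //.
- apply: measurableT_comp => //; apply/measurable_EFinP/measurable_funM => //.
  by apply/measurable_EFinP; exact: (measurable_int _ ig).
- exact: measurableT_comp.
- apply: ae_imply fM => x fM Dx /=; rewrite lee_fin !normrM !normr_id.
  by rewrite ler_wpM2r// (le_trans (fM Dx))// ler_norm.
Qed.

Lemma Rintegral_ae_bounded_mul D f g (M : R) : measurable D ->
  measurable_fun D f -> {ae mu, forall x, D x -> `|f x| <= M} ->
  mu.-integrable D (EFin \o g) ->
  `|\int[mu]_(x in D) (f x * g x)| <= \int[mu]_(x in D) (`|M| * `|g x|).
Proof.
move=> mD mf fM ig; have ifg := integrable_ae_bounded_mul mD mf fM ig.
apply: (le_trans (le_normr_Rintegral mD ifg)).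
have iMg : mu.-integrable D (EFin \o (fun x => `|M| * `|g x|)).
  by apply: integrable_scale => //; exact: (integrable_abse ig).
have iafg : mu.-integrable D (EFin \o (fun x => `|f x * g x|)).
  exact: (integrable_abse ifg).
rewrite /Rintegral; apply: fine_le.
- exact: (integrable_fin_num _ iafg).
- exact: (integrable_fin_num _ iMg).
- apply: ae_ge0_le_integral => //.
  + exact: (measurable_int _ iafg).
  + exact: (measurable_int _ iMg).
  + apply: ae_imply fM => x fM Dx; rewrite lee_fin normrM.
    by rewrite ler_wpM2r// (le_trans (fM Dx))// ler_norm.
Qed.

(** The du Bois-Reymond lemma is used in each variable. In time it shows, for fixed b, that the
    pairings of v and u_x with b agree at almost every t. Letting b run through the countably many
    rational cutoffs leaves one null set of times, off which the lemma applies in x. *)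
Lemma weak_px_unique (u ux v : R -> R -> R) (M : R) :
  continuous (uncurry u) -> continuous (uncurry ux) ->
  (forall t x, is_derive x (1 : R) (u t) (ux t x)) ->
  (forall t x, `|ux t x| <= M) ->
  weak_px u v -> essentially_bounded v ->
  {ae mu, forall t, 0 < t < 1 -> {ae mu, forall x, v t x = ux t x}}.
Proof.
move=> cu cux uux uxM uv [mv [N vN]].
have {vN}secN : {ae mu, forall t, 0 < t < 1 -> {ae mu, forall x, `|v t x| <= N}}.
  apply: ae_imply (ae_product_sections vN) => t H t01.
  by apply: ae_imply H => x; apply; split; rewrite /= ?in_itv.
have ib b (c d : R) : bump_on c d b -> mu.-integrable setT (EFin \o b).
  move=> [sb b0]; apply: integrable_continuous_support b0 => //.
  exact: smooth1_continuous.
have cb b (c d : R) : bump_on c d b -> continuous b.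
  by move=> [sb _]; exact: smooth1_continuous.
pose I01 : set (measurableTypeR R) := `]0, 1[%classic.
have mI : measurable I01 by exact: measurable_itv.
have mV b (c d : R) : bump_on c d b -> measurable_fun I01 (slice v b).
  by move=> /cb ?; exact: measurable_slice_strip.
have VN b (c d : R) : bump_on c d b ->
    {ae mu, forall t, I01 t -> `|slice v b t| <= \int[mu]_x (`|N| * `|b x|)}.
  move=> bb; apply: ae_imply secN => t vN; rewrite /I01/= in_itv/= => t01.
  apply: Rintegral_ae_bounded_mul => //; last exact: ib bb.
    exact: measurable_strip_slice t01 mv.
  by apply: ae_imply (vN t01) => x.
have iP b (c d : R) : bump_on c d b -> continuous (slice ux b).
  by move=> bb; exact: slice_continuous bb.
(* Cut off outside ]0, 1[, where nothing is known about [v], to obtain a measurable and essentially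
   bounded function on the whole line. *)
pose h b : R -> R := (fun t => slice v b t - slice ux b t) \_ I01.
have PN b (c d : R) : bump_on c d b ->
    forall t, `|slice ux b t| <= \int[mu]_x (`|M| * `|b x|).
  move=> bb t; apply: Rintegral_ae_bounded_mul => //; last exact: ib bb.
  - by apply: continuous_measurable_fun; exact: continuous_uncurryl.
  - exact: aeW.
have slicesE b (c d : R) : bump_on c d b ->
    {ae mu, forall t, 0 < t < 1 -> slice v b t = slice ux b t}.
  move=> bb.
  have mh : measurable_fun setT (h b).
    apply: (measurable_restrictT _ mI).1; apply: measurable_funB; first exact: mV bb.
    by apply: measurable_funTS; apply: continuous_measurable_fun; exact: iP bb.
  have hN : {ae mu, forall t, `|h b t| <=
      \int[mu]_x (`|N| * `|b x|) + \int[mu]_x (`|M| * `|b x|)}.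
    apply: ae_imply (VN b c d bb) => t Vt; rewrite /h patchE; case: ifPn => [|_].
      rewrite inE => t01; apply: le_trans (ler_normB _ _) _; apply: lerD; first exact: Vt.
      exact: PN bb _.
    by rewrite normr0 addr_ge0// Rintegral_ge0// => x _; rewrite mulr_ge0.
  have lh := ae_bounded_locally_integrable mh hN.
  have : {ae mu, forall t, `]0, 1[%classic t -> h b t = 0}.
    apply: (du_bois_reymond (interval_open _ _) lh) => // p q n pq01.
    set a := cutoff _ _ n; have ba : bump_on (ratr p) (ratr q) a by exact: bump_cutoff.
    have := uv _ (test_function_tensor ba bb pq01).
    rewrite /iint.
    have ia : mu.-integrable I01 (EFin \o a).
      by apply: (@integrableS _ _ _ mu setT) => //; exact: ib ba.
    have iva : mu.-integrable I01 (EFin \o (fun t => slice v b t * a t)).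
      exact: (integrable_ae_bounded_mul mI (mV b c d bb) (VN b c d bb) ia).
    have iua : mu.-integrable I01 (EFin \o (fun t => slice ux b t * a t)).
      apply: (integrable_ae_bounded_mul mI _ _ ia).
        by apply: measurable_funTS; apply: continuous_measurable_fun; exact: iP bb.
      by apply: aeW => t _; exact: PN bb t.
    have -> : \int[mu]_(t in `]0, 1[) \int[mu]_x (u t x * px (fun t x => a t * b x) t x) =
        - \int[mu]_(t in I01) (slice ux b t * a t).
      rewrite -mulN1r -RintegralZl//; apply: eq_Rintegral => t _.
      rewrite mulN1r -mulNr mulrC -(slice_by_parts cux (uux t) bb) /slice -RintegralZl//.
        apply: eq_Rintegral => x _; rewrite /px derive1Ml; first by rewrite mulrCA.
        by apply: smooth1_derivable; case: bb.
      exact: (integrable_slice _ cu (bump_derive1 bb)).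
    have -> : \int[mu]_(t in `]0, 1[) \int[mu]_x (v t x * (a t * b x)) =
        \int[mu]_(t in I01) (slice v b t * a t).
      apply: eq_ae_Rintegral; apply: ae_imply secN => t vN.
      rewrite /I01/= in_itv/= => t01; rewrite mulrC /slice -RintegralZl//.
        by apply: eq_Rintegral => x _; rewrite mulrCA.
      apply: (integrable_ae_bounded_mul measurableT _ _ (ib b c d bb)).
        exact: measurable_strip_slice t01 mv.
      by apply: ae_imply (vN t01) => x vx _; exact: vx.
    move=> /oppr_inj E.
    have -> : \int[mu]_x (h b x * a x) = \int[mu]_(t in I01) (slice v b t * a t - slice ux b t * a t).
      rewrite [RHS]Rintegral_mkcond; apply: eq_Rintegral => t _.
      by rewrite /h !patchE; case: ifPn => _; rewrite ?mul0r// mulrBl.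
    by rewrite RintegralB// E subrr.
  apply: ae_imply => t ht t01.
  have tI : I01 t by rewrite /I01/= in_itv.
  by have := ht tI; rewrite /h patchE mem_set// => /subr0_eq.
have count : {ae mu, forall t, forall k : rat * rat * nat, 0 < t < 1 ->
    slice v (cutoff (ratr k.1.1) (ratr k.1.2) k.2) t =
    slice ux (cutoff (ratr k.1.1) (ratr k.1.2) k.2) t}.
  apply: (@ae_forall_countable _ _ _ mu _ (fun (k : rat * rat * nat) t => 0 < t < 1 ->
    slice v (cutoff (ratr k.1.1) (ratr k.1.2) k.2) t =
    slice ux (cutoff (ratr k.1.1) (ratr k.1.2) k.2) t)) => k.
  exact: slicesE (bump_cutoff _ _ _).
apply: ae_imply2 secN count => t vN kt t01.
have mvt := measurable_strip_slice t01 mv.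
have muxt : measurable_fun setT (ux t).
  by apply: continuous_measurable_fun; exact: continuous_uncurryl.
have mg : measurable_fun setT (fun x => v t x - ux t x) by exact: measurable_funB.
have gN : {ae mu, forall x, `|v t x - ux t x| <= N + M}.
  apply: ae_imply (vN t01) => x vx; apply: le_trans (ler_normB _ _) _.
  by apply: lerD.
have gd0 : {ae mu, forall x, setT x -> v t x - ux t x = 0}.
  apply: (du_bois_reymond openT (ae_bounded_locally_integrable mg gN)) => p q n _.
  have ba := @bump_cutoff R (ratr p) (ratr q) n.
  under eq_Rintegral do rewrite mulrBl.
  rewrite RintegralB//.
  - by apply/eqP; rewrite subr_eq0; apply/eqP; exact: (kt (p, q, n)).
  - apply: (integrable_ae_bounded_mul measurableT mvt _ (ib _ _ _ ba)).
    by apply: ae_imply (vN t01) => x vx _; exact: vx.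
  - exact: (integrable_slice _ cux ba).
by apply: ae_imply gd0 => x /(_ I)/subr0_eq.
Qed.

End weak_derivative_unique.

(** * Tensor test functions in the Parisi equation *)

Section weak_equation.
Context {R : realType}.
Notation mu := (@lebesgue_measure R).
Implicit Types (F G : R -> R -> R) (f g a b : R -> R) (s t x c d alpha beta : R).

Variables (A m : R -> R).
Hypothesis cA : continuous A.
Hypothesis mm : measurable_fun setT m.
Hypothesis m01 : forall t, 0 <= m t <= 1.

Let I01 : set (measurableTypeR R) := `]0, 1[%classic.
Let mI : measurable I01. Proof. exact: measurable_itv. Qed.

Lemma continuous_mul f g : continuous f -> continuous g -> continuous (fun x => f x * g x).
Proof. by move=> cf cg x; apply: cvgM; [exact: cf | exact: cg]. Qed.

Lemma integrable_bump_mul a alpha beta f : bump_on alpha beta a -> continuous f ->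
  mu.-integrable I01 (EFin \o (fun t => a t * f t)).
Proof.
move=> [sa a0] cf; apply: (@integrable_continuous_support _ _ _ alpha beta) => //.
  by apply: continuous_mul => //; exact: smooth1_continuous.
by move=> x xab; rewrite a0// mul0r.
Qed.

Lemma integrable_source a alpha beta f g : bump_on alpha beta a ->
  continuous f -> continuous g ->
  mu.-integrable I01 (EFin \o (fun t => a t * (A t * (f t + m t * g t)))).
Proof.
move=> ba cf cg.
have -> : (fun t => a t * (A t * (f t + m t * g t))) =
  (fun t => a t * (A t * f t) + m t * (a t * (A t * g t))).
  by apply/funext => t; ring.
have i1 := integrable_bump_mul ba (continuous_mul cA cf).
have i2 := integrable_bump_mul ba (continuous_mul cA cg).
have i3 : mu.-integrable I01 (EFin \o (fun t => m t * (a t * (A t * g t)))).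
  apply: (@integrable_ae_bounded_mul _ _ _ _ 1 mI _ _ i2).
    by apply: measurable_funTS; exact: mm.
  by apply: aeW => t _; have /andP[m0 m1] := m01 t; rewrite ger0_norm.
exact: (integrableD mI i1 i3).
Qed.

(** All derivatives fall on a or b, and v is u_x for almost every t. The support of a may reach
    beyond time 1, which is why a terminal term remains. *)
Lemma tensor_weak_equation (u ux v : R -> R -> R) :
  continuous (uncurry u) -> continuous (uncurry ux) ->
  {ae mu, forall t, 0 < t < 1 -> {ae mu, forall x, v t x = ux t x}} ->
  (forall phi, test_function (`]0, +oo[ `*` setT) phi ->
     0 = iint (fun t x => - (u t x * pt phi t x) +
       A t * (u t x * px (px phi) t x + m t * v t x ^+ 2 * phi t x)) +
     \int[mu]_x (phi 1 x * ln (cosh x))) ->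
  forall a b alpha beta c d, bump_on alpha beta a -> 0 < alpha -> bump_on c d b ->
  \int[mu]_(t in I01) (derive1 a t * slice u b t) =
  \int[mu]_(t in I01) (a t * (A t * (slice u (derive1 (derive1 b)) t +
     m t * slice (fun t x => ux t x ^+ 2) b t))) +
  a 1 * \int[mu]_x (ln (cosh x) * b x).
Proof.
move=> cu cux vux H a b alpha beta c d ba a0 bb.
have sub : `[alpha, beta]%classic `<=` `]0 : R, +oo[%classic.
  by move=> x /=; rewrite !in_itv/= andbT => /andP[/(lt_le_trans a0)].
have {H} := H _ (test_function_tensor ba bb sub).
have [sa _] := ba; have [sb b0] := bb.
have bb1 := bump_derive1 bb; have bb2 := bump_derive1 bb1.
have cux2 : continuous (uncurry (fun t x => ux t x ^+ 2)).
  move=> z; have -> : uncurry (fun t x => ux t x ^+ 2) = (fun z => uncurry ux z * uncurry ux z).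
    by apply/funext => -[t x]; rewrite /= expr2.
  by apply: cvgM; exact: cux.
set K := slice (fun t x => ux t x ^+ 2) b.
have iD : mu.-integrable I01 (EFin \o (fun t => derive1 a t * slice u b t)).
  by apply: integrable_bump_mul (bump_derive1 ba) _; exact: slice_continuous bb.
have iS : mu.-integrable I01 (EFin \o (fun t => a t * (A t * (slice u (derive1 (derive1 b)) t + m t * K t)))).
  apply: (integrable_source ba); first exact: slice_continuous bb2.
  exact: slice_continuous bb.
have -> : iint (fun t x => - (u t x * pt (fun t x => a t * b x) t x) +
       A t * (u t x * px (px (fun t x => a t * b x)) t x + m t * v t x ^+ 2 * (a t * b x))) =
  \int[mu]_(t in I01) (a t * (A t * (slice u (derive1 (derive1 b)) t + m t * K t)) - derive1 a t * slice u b t).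
  apply: eq_ae_Rintegral; apply: ae_imply vux => t vt; rewrite /= in_itv/= => t01.
  transitivity (\int[mu]_x ((- derive1 a t) * (u t x * b x) +
     ((A t * a t) * (u t x * derive1 (derive1 b) x) + (A t * m t * a t) * (ux t x ^+ 2 * b x)))).
    apply: eq_ae_Rintegral; apply: ae_imply (vt t01) => x -> _.
    have -> : pt (fun t x => a t * b x) t x = derive1 a t * b x.
      by rewrite /pt derive1Mr//; exact: smooth1_derivable.
    have pxE g y : smooth1 g -> px (fun t x => a t * g x) t y = a t * derive1 g y.
      by move=> sg; rewrite /px derive1Ml//; exact: smooth1_derivable.
    have -> : px (px (fun t x => a t * b x)) t x = a t * derive1 (derive1 b) x.
      rewrite -(pxE (derive1 b)); last exact: smooth1_derive1.
      by rewrite /px; congr (derive1 _ _); apply/funext => y; exact: pxE.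
    by ring.
  have i1 := integrable_slice t cu bb; have i2 := integrable_slice t cu bb2.
  have i3 := integrable_slice t cux2 bb.
  have j1 := integrable_scale (- derive1 a t) measurableT i1.
  have j2 := integrable_scale (A t * a t) measurableT i2.
  have j3 := integrable_scale (A t * m t * a t) measurableT i3.
  rewrite RintegralD//; last exact: (integrableD measurableT j2 j3).
  rewrite RintegralD// !RintegralZl//.
  by rewrite /K /slice; ring.
rewrite RintegralB//.
have -> : \int[mu]_x (a 1 * b x * ln (cosh x)) = a 1 * \int[mu]_x (ln (cosh x) * b x).
  rewrite -RintegralZl//.
    by apply: eq_Rintegral => x _; ring.
  apply: (@integrable_continuous_support _ _ _ c d) => //.
    apply: continuous_mul; last exact: smooth1_continuous.
    move=> x; apply/differentiable_continuous/derivable1_diffP.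
    exact: (@ex_derive _ _ _ _ _ _ _ (is_derive_lncosh _)).
  by move=> x xcd; rewrite b0// mulr0.
by lra.
Qed.

(** The weak form in time and space of F_t = - A * (G1 + m * G2). The condition beta < 1 removes the
    terminal term. *)
Definition interior_identity F G1 G2 := forall a b alpha beta c d,
  bump_on alpha beta a -> 0 < alpha -> beta < 1 -> bump_on c d b ->
  \int[mu]_(t in I01) (derive1 a t * slice F b t) =
  \int[mu]_(t in I01) (a t * (A t * (slice G1 b t + m t * slice G2 b t))).

(** Testing with b' and integrating by parts changes the sign of both sides alike. The equation is
    thus differentiated in space while its time part stays weak. *)
Lemma interior_identity_derive F G1 G2 F' G1' G2' :
  continuous (uncurry F') -> continuous (uncurry G1') -> continuous (uncurry G2') ->
  (forall t x, is_derive x (1 : R) (F t) (F' t x)) ->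
  (forall t x, is_derive x (1 : R) (G1 t) (G1' t x)) ->
  (forall t x, is_derive x (1 : R) (G2 t) (G2' t x)) ->
  interior_identity F G1 G2 -> interior_identity F' G1' G2'.
Proof.
move=> cF cG1 cG2 dF dG1 dG2 H a b alpha beta c d ba a0 b1 bb.
have := H _ _ _ _ _ _ ba a0 b1 (bump_derive1 bb).
have iD : mu.-integrable I01 (EFin \o (fun t => derive1 a t * slice F' b t)).
  by apply: integrable_bump_mul (bump_derive1 ba) _; exact: slice_continuous bb.
have iS : mu.-integrable I01 (EFin \o (fun t => a t * (A t * (slice G1' b t + m t * slice G2' b t)))).
  by apply: (integrable_source ba); exact: slice_continuous bb.
under eq_Rintegral do rewrite (slice_by_parts cF (dF _) bb) mulrN -mulN1r.
under [in RHS]eq_Rintegral do rewrite (slice_by_parts cG1 (dG1 _) bb) (slice_by_parts cG2 (dG2 _) bb)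
  mulrN -opprD !mulrN -mulN1r.
by rewrite !RintegralZl// !mulN1r => /oppr_inj.
Qed.

End weak_equation.

(** * Pointwise evolution *)

Section pointwise_evolution.
Context {R : realType}.
Notation mu := (@lebesgue_measure R).
Implicit Types (F G : R -> R -> R) (f g a b : R -> R) (s t x c d alpha beta : R).

Lemma kern_slice F t x c (e h : R) : 0 < h -> continuous (uncurry F) ->
  (forall y, `|y - x| <= 2 * h -> `|F t y - c| <= e) ->
  `|slice F (kern x h) t - c| <= e.
Proof.
move=> h0 cF Fc; have bk := bump_kern x h0.
apply: kern_average => //; first exact: integrable_slice cF bk.
by move=> y /andP[y1 y2]; apply: Fc; rewrite ger0_norm; lra.
Qed.

Lemma dist_sub_le (p q s t h : R) : `|p - t| <= 2 * h -> `|q - s| <= 2 * h ->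
  `|p - q - (t - s)| <= 4 * h.
Proof.
rewrite !ler_norml => /andP[? ?] /andP[? ?].
by apply/andP; split; lra.
Qed.

(** [K0] and [K2] are mollified values of F at two times, [M] is the mass of the ramp between them,
    within 4 * h of the elapsed time [l]. The two averages and the mass contribute errors of at most
    eta / 3 each. *)
Lemma increment_arith (F0 F2 K0 K2 M c e h eta l : R) : 0 <= e -> 0 < h ->
  (e + `|c| + 1) * 4 * 3 * h < eta ->
  `|K0 - F0| <= eta / 3 -> `|K2 - F2| <= eta / 3 -> `|M - l| <= 4 * h ->
  `|K0 - K2 - c * M| <= e * M -> `|F2 - F0 + c * l| <= e * l + eta.
Proof.
move=> e0 h0 hC avg0 avg2 HM HK.
have eM : e * (M - l) <= e * (4 * h).
  by rewrite ler_wpM2l// (le_trans (ler_norm _)).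
have cM : `|c * (M - l)| <= `|c| * (4 * h) by rewrite normrM ler_wpM2l.
move: avg0 avg2 HK cM; rewrite !ler_norml => /andP[? ?] /andP[? ?] /andP[? ?] /andP[? ?].
by apply/andP; split; lra.
Qed.

(** A ramp over a time 3 * h has mass at most 7 * h, so the source term [K1] costs at most C * 7 *
    h, below eta / 3; the averages of F and T cost eta / 3 each. *)
Lemma terminal_arith (F1 T1 K0 K1 K2 M M' C h eta : R) : 0 <= C -> 0 < h ->
  (C + 1) * 7 * 3 * h < eta -> M' <= M -> `|M - 3 * h| <= 4 * h ->
  `|K0 - F1| <= eta / 3 -> `|K2 - T1| <= eta / 3 -> `|K1| <= C * M' -> K0 = K1 + K2 ->
  `|F1 - T1| <= 0 + eta.
Proof.
move=> C0 h0 hC MM' HM.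
have CM : C * M' <= C * (7 * h).
  rewrite ler_wpM2l// (le_trans MM')//; move: HM; rewrite ler_norml => /andP[? ?]; lra.
rewrite add0r !ler_norml => /andP[? ?] /andP[? ?] /andP[? ?] ?.
by apply/andP; split; lra.
Qed.

(** A smoothed indicator of [s, t]. Its derivative is the kernel at s minus the kernel at t, so
    testing with it produces an increment of F. *)
Definition ramp s t h y := stp s h y - stp t h y.

Lemma derive1_ramp s t h y : derive1 (ramp s t h) y = kern s h y - kern t h y.
Proof.
rewrite derive1E; apply: derive_val; apply: is_derive_sub.
  exact/smooth1_is_derive/smooth1_stp.
exact/smooth1_is_derive/smooth1_stp.
Qed.

Lemma ramp_ge0 s t h y : 0 < h -> s + h <= t -> 0 <= ramp s t h y.
Proof.
move=> h0 st; rewrite /ramp subr_ge0; have [y1|y1] := leP y (t + h).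
  by rewrite [stp t _ _]stp0// stp_ge0.
by rewrite [stp s _ _]stp1 ?stp_le1//; lra.
Qed.

(** Integration by parts against the identity function turns the mass into the mean of the kernel at
    t minus that of the kernel at s, each within 2 * h of its base point. *)
Lemma ramp_mass s t h : 0 < h -> s <= t ->
  `|\int[mu]_y ramp s t h y - (t - s)| <= 4 * h.
Proof.
move=> h0 st; have ba := bump_stpB h0 st.
have did y : is_derive y (1 : R) id (cst 1 y) by exact: is_derive_id.
have c1 : continuous (cst 1 : R -> R) by move=> y; exact: cvg_cst.
have := Rintegral_by_parts_bump did c1 ba.
under [in RHS]eq_Rintegral do rewrite mul1r.
rewrite -/(ramp s t h) => H.
have cid' : continuous (@id R) by move=> y; exact: cvg_id.
have ik r : mu.-integrable setT (EFin \o (fun y => y * kern r h y)).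
  have [sk k0] := bump_kern r h0.
  apply: (@integrable_continuous_support _ _ _ (r + h) (r + 2 * h)) => //.
    by apply: continuous_mul => //; exact: smooth1_continuous.
  by move=> x xr; rewrite k0// mulr0.
have E : \int[mu]_y ramp s t h y = \int[mu]_y (y * kern t h y) - \int[mu]_y (y * kern s h y).
  rewrite -RintegralB//; apply: oppr_inj; rewrite -H -mulN1r -RintegralZl; last 2 first.
  - by [].
  - exact: (integrableB measurableT (ik t) (ik s)).
  apply: eq_Rintegral => y _.
  by rewrite /= derive1_ramp mulrBr mulN1r opprB.
have K r : `|\int[mu]_y (y * kern r h y) - r| <= 2 * h.
  apply: kern_average => // y /andP[y1 y2]; clear -h0 y1 y2.
  by rewrite ger0_norm; lra.
by rewrite E; exact: dist_sub_le (K t) (K s).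
Qed.

Section right_derivative.
Variables (A m : R -> R).
Hypothesis cA : continuous A.
Hypothesis mm : measurable_fun setT m.
Hypothesis m01 : forall t, 0 <= m t <= 1.

Let I01 : set (measurableTypeR R) := `]0, 1[%classic.
Let mI : measurable I01. Proof. exact: measurable_itv. Qed.

Let src G1 G2 t x := A t * (G1 t x + m t * G2 t x).

Lemma source_slice G1 G2 t x c (e h : R) : 0 < h ->
  continuous (uncurry G1) -> continuous (uncurry G2) ->
  (forall y, `|y - x| <= 2 * h -> `|src G1 G2 t y - c| <= e) ->
  `|A t * (slice G1 (kern x h) t + m t * slice G2 (kern x h) t) - c| <= e.
Proof.
move=> h0 c1 c2 H; have bk := bump_kern x h0.
have i1 := integrable_slice t c1 bk; have i2 := integrable_slice t c2 bk.
have i2' := integrable_scale (m t) measurableT i2.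
have i3 : mu.-integrable setT (EFin \o (fun y => G1 t y * kern x h y + m t * (G2 t y * kern x h y))).
  exact: (integrableD measurableT i1 i2').
have -> : A t * (slice G1 (kern x h) t + m t * slice G2 (kern x h) t) =
    \int[mu]_y (src G1 G2 t y * kern x h y).
  transitivity (\int[mu]_y (A t * (G1 t y * kern x h y + m t * (G2 t y * kern x h y)))).
    by rewrite RintegralZl// RintegralD// RintegralZl.
  by apply: eq_Rintegral => y _; rewrite /src; ring.
apply: kern_average => //.
  have := integrable_scale (A t) measurableT i3; apply: eq_integrable => // y _ /=.
  by congr (_%:E); rewrite /src; ring.
by move=> y /andP[y1 y2]; apply: H; rewrite ger0_norm; lra.
Qed.

Lemma source_integral a alpha beta (n : R -> R) c (e : R) : bump_on alpha beta a ->
  (forall t, 0 <= a t) ->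
  mu.-integrable I01 (EFin \o (fun t => a t * n t)) ->
  (forall t, 0 < t < 1 -> alpha <= t <= beta -> `|n t - c| <= e) ->
  `|\int[mu]_(t in I01) (a t * n t) - c * \int[mu]_(t in I01) a t| <=
    e * \int[mu]_(t in I01) a t.
Proof.
move=> [sa a0] age0 ian nc.
have ia : mu.-integrable I01 (EFin \o a).
  exact: (integrable_continuous_support mI (smooth1_continuous sa) a0).
have ica r := integrable_scale r mI ia.
rewrite -!RintegralZl// -RintegralB//.
have iB : mu.-integrable I01 (EFin \o (fun t => a t * n t - c * a t)).
  exact: (integrableB mI ian (ica c)).
apply: (le_trans (le_normr_Rintegral mI iB)).
apply: le_Rintegral => //; first exact: (integrable_abse iB).
move=> t; rewrite /I01/= in_itv/= => t01.
case: (boolP (alpha <= t <= beta)) => tab; last first.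
  by rewrite a0// !(mul0r, mulr0) subrr normr0.
rewrite [c * _]mulrC -mulrBr normrM ger0_norm// mulrC ler_wpM2r//.
exact: nc.
Qed.

Lemma continuous2_dist F t x (e : R) : continuous (uncurry F) -> 0 < e ->
  exists2 dl, 0 < dl & forall s y, `|s - t| < dl -> `|y - x| < dl -> `|F s y - F t x| < e.
Proof.
move=> cF e0; have /cvgrPdist_lt/(_ _ e0) := cF (t, x).
case=> -[P Q] /= [/nbhs_ballP[d1 /= d10 d1P] /nbhs_ballP[d2 /= d20 d2Q]] PQ.
exists (Num.min d1 d2); first by rewrite lt_min d10.
move=> s y; rewrite !lt_min => /andP[s1 _] /andP[_ y2].
rewrite distrC; apply: (PQ (s, y)); split => /=.
  by apply: d1P; rewrite /ball/= distrC.
by apply: d2Q; rewrite /ball/= distrC.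
Qed.

(** Test with the ramp in time and the kernel at x0 in space, and let h tend to 0. The ramp vanishes
    up to time t0 + h, so the source matters only strictly after t0. *)
Lemma increment_bound F G1 G2 t0 t2 x0 c (e dl : R) :
  continuous (uncurry F) -> continuous (uncurry G1) -> continuous (uncurry G2) ->
  interior_identity A m F G1 G2 ->
  0 <= t0 -> t0 < t2 -> t2 < t0 + dl -> t2 < 1 -> 0 <= e ->
  (forall t x, t0 < t < t0 + dl -> `|x - x0| < dl -> `|src G1 G2 t x - c| <= e) ->
  `|F t2 x0 - F t0 x0 + c * (t2 - t0)| <= e * (t2 - t0).
Proof.
move=> cF c1 c2 id t00 t02 t2d t21 e0 Hc.
apply/ler_addgt0Pr => eta eta0.
have eta3 : 0 < eta / 3 by rewrite divr_gt0.
have [d0 d00 Hd0] := continuous2_dist t0 x0 cF eta3.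
have [d2 d20 Hd2] := continuous2_dist t2 x0 cF eta3.
have C0 : 0 < (e + `|c| + 1) * 4 * 3 by rewrite !mulr_gt0// ltr_wpDl// addr_ge0.
near (0 : R)^'+ => h.
have h0 : 0 < h by [].
have hd : 2 * h < dl.
  by rewrite -ltr_pdivlMl//; near: h; apply: nbhs_right_lt; rewrite mulr_gt0//; lra.
have hd0 : 2 * h < d0.
  by rewrite -ltr_pdivlMl//; near: h; apply: nbhs_right_lt; rewrite mulr_gt0.
have hd2 : 2 * h < d2.
  by rewrite -ltr_pdivlMl//; near: h; apply: nbhs_right_lt; rewrite mulr_gt0.
have ht2 : 2 * h < t0 + dl - t2.
  by rewrite -ltr_pdivlMl//; near: h; apply: nbhs_right_lt; rewrite mulr_gt0//; lra.
have ht21 : 2 * h < 1 - t2.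
  by rewrite -ltr_pdivlMl//; near: h; apply: nbhs_right_lt; rewrite mulr_gt0//; lra.
have ht02 : h < t2 - t0 by near: h; apply: nbhs_right_lt; lra.
have hC : (e + `|c| + 1) * 4 * 3 * h < eta.
  by rewrite -ltr_pdivlMl//; near: h; apply: nbhs_right_lt; rewrite mulr_gt0// invr_gt0.
have ba : bump_on (t0 + h) (t2 + 2 * h) (ramp t0 t2 h) by apply: bump_stpB => //; exact: ltW.
have [sa a0] := ba.
have bk := bump_kern x0 h0.
have a_pos : 0 < t0 + h by clear -cA mm m01 mI h0 t00; lra.
have b_lt : t2 + 2 * h < 1 by clear -cA mm m01 mI ht21; lra.
pose S := slice F (kern x0 h).
pose n t := A t * (slice G1 (kern x0 h) t + m t * slice G2 (kern x0 h) t).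
have E : \int[mu]_(t in I01) (derive1 (ramp t0 t2 h) t * S t) =
    \int[mu]_(t in I01) (ramp t0 t2 h t * n t) := id _ _ _ _ _ _ ba a_pos b_lt bk.
have cS : continuous S by exact: slice_continuous bk.
have ikS r : mu.-integrable I01 (EFin \o (fun t => S t * kern r h t)).
  have -> : (fun t => S t * kern r h t) = (fun t => kern r h t * S t).
    by apply/funext => t; rewrite mulrC.
  exact: integrable_bump_mul (bump_kern r h0) cS.
have E' : \int[mu]_(t in I01) (derive1 (ramp t0 t2 h) t * S t) =
    \int[mu]_(t in I01) (S t * kern t0 h t) - \int[mu]_(t in I01) (S t * kern t2 h t).
  rewrite -RintegralB//; apply: eq_Rintegral => t _.
  by rewrite derive1_ramp mulrC mulrBr.
rewrite {}E' in E.
have avg r d : 0 <= r -> r + 2 * h < 1 -> 2 * h < d ->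
    (forall s y, `|s - r| < d -> `|y - x0| < d -> `|F s y - F r x0| < eta / 3) ->
    `|\int[mu]_(t in I01) (S t * kern r h t) - F r x0| <= eta / 3.
  move=> r0 r1 hdd Hd; apply: kern_average => //.
    move=> t; rewrite /I01/= !in_itv/= => /andP[tr1 tr2].
    by clear -cA mm m01 mI tr1 tr2 h0 r0 r1; apply/andP; split; lra.
  move=> t /andP[tr1 tr2]; apply: kern_slice => // y yx; apply/ltW/Hd.
    by clear -cA mm m01 mI tr1 tr2 h0 hdd; rewrite ger0_norm; lra.
  exact: le_lt_trans hdd.
have t0h1 : t0 + 2 * h < 1 by clear -cA mm m01 mI b_lt t02; lra.
have avg0 := avg t0 d0 t00 t0h1 hd0 Hd0.
have avg2 := avg t2 d2 (le_trans t00 (ltW t02)) b_lt hd2 Hd2.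
have ian : mu.-integrable I01 (EFin \o (fun t => ramp t0 t2 h t * n t)).
  apply: (integrable_source cA mm m01 ba); exact: slice_continuous bk.
have th02 : t0 + h <= t2 by clear -cA mm m01 mI ht02; lra.
have aI := source_integral ba (fun t => ramp_ge0 t h0 th02) ian.
have {aI} := aI c e.
have nc t : 0 < t < 1 -> t0 + h <= t <= t2 + 2 * h -> `|n t - c| <= e.
  move=> _ /andP[t1 t3]; apply: source_slice => // y yx; apply: Hc.
    by clear -cA mm m01 mI t1 t3 h0 ht2; apply/andP; split; lra.
  exact: le_lt_trans hd.
move=> /(_ nc).
have massE : \int[mu]_(t in I01) ramp t0 t2 h t = \int[mu]_t ramp t0 t2 h t.
  rewrite (Rintegral_support _ a0); last first.
    move=> t; rewrite /I01/= !in_itv/= => /andP[tr1 tr2].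
    by clear -cA mm m01 mI tr1 tr2 a_pos b_lt; apply/andP; split; lra.
  by rewrite [RHS](Rintegral_support _ a0).
rewrite massE.
rewrite -E; exact: (increment_arith e0 h0 hC avg0 avg2 (ramp_mass h0 (ltW t02))).
Unshelve. all: by end_near. Qed.

(** Right continuity of m makes the source converge along right neighbourhoods of t0 times full
    neighbourhoods of x0; the increment bound is then divided by the time step. *)
Lemma identity_right_derive F G1 G2 t0 x0 :
  continuous (uncurry F) -> continuous (uncurry G1) -> continuous (uncurry G2) ->
  interior_identity A m F G1 G2 -> 0 <= t0 < 1 -> m t @[t --> t0^'+] --> m t0 ->
  right_derive (F ^~ x0) t0 (- src G1 G2 t0 x0).
Proof.
move=> cF c1 c2 id /andP[t00 t01] mt0.
set c := src G1 G2 t0 x0.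
have prodE G : continuous (uncurry G) ->
    G z.1 z.2 @[z --> filter_prod (t0^'+) (nbhs x0)] --> G t0 x0.
  move=> cG; have H : (z.1, z.2) @[z --> filter_prod (t0^'+) (nbhs x0)] --> (t0, x0).
    apply: (@cvg_pair _ _ _ _ (nbhs t0) (nbhs x0)); last exact: cvg_snd.
    apply: cvg_trans; first exact: cvg_fst.
    exact: cvg_within.
  apply: (@cvg_comp _ _ _ (fun z => (z.1, z.2)) (uncurry G) _ _ _ H).
  exact (cG (t0, x0)).
have srcE : src G1 G2 z.1 z.2 @[z --> filter_prod (t0^'+) (nbhs x0)] --> c.
  apply: cvgM.
    apply: (@cvg_comp _ _ _ fst A _ (nbhs t0)); last exact: cA.
    by apply: cvg_trans; [exact: cvg_fst | exact: cvg_within].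
  apply: cvgD; first exact: prodE.
  apply: cvgM; last exact: prodE.
  apply: (@cvg_comp _ _ _ fst m _ (t0^'+)) => //; exact: cvg_fst.
rewrite /right_derive; apply/cvgrPdist_le => e e0.
move/cvgrPdist_le : srcE => /(_ _ e0)[[P Q]/= [[d1 /= d10 d1P] /nbhs_ballP[d2 /= d20 d2Q]] PQ].
pose dl := Num.min d1 d2.
have dl0 : 0 < dl by rewrite lt_min d10.
have Hc t x : t0 < t < t0 + dl -> `|x - x0| < dl -> `|src G1 G2 t x - c| <= e.
  rewrite /dl; move=> /andP[tt0 td] xx0; rewrite distrC; apply: (PQ (t, x)); split => /=.
    apply: d1P => //=; rewrite distrC gtr0_norm ?subr_gt0// ltrBlDl (lt_le_trans td)//.
    by rewrite lerD2l ge_min lexx.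
  apply: d2Q; rewrite /ball/= distrC (lt_le_trans xx0)//.
  by rewrite ge_min lexx orbT.
near=> s.
have s0 : 0 < s by [].
have s1 : s < 1 - t0 by near: s; apply: nbhs_right_lt; lra.
have s2 : s < dl by near: s; apply: nbhs_right_lt.
have p1 : t0 < t0 + s by rewrite ltrDl.
have p2 : t0 + s < t0 + dl by rewrite ltrD2l.
have p3 : t0 + s < 1 by rewrite -ltrBrDl.
have := increment_bound cF c1 c2 id t00 p1 p2 p3 (ltW e0) Hc.
rewrite (_ : t0 + s - t0 = s); last by rewrite addrAC subrr add0r.
move=> H.
rewrite -(ler_pM2r s0); apply: le_trans H.
have -> : F (t0 + s) x0 - F t0 x0 + c * s =
    - ((- c - s^-1 * (F (t0 + s) x0 - F t0 x0)) * s).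
  have sn0 : s != 0 by rewrite gt_eqF.
  clear -sn0 cA mm m01 mI; move: (F (t0 + s) x0) (F t0 x0) c => p q k.
  by field.
by rewrite normrN normrM (gtr0_norm s0).
Unshelve. all: by end_near. Qed.

(** Test with a ramp that rises shortly before time 1 and equals 1 there: the left side tends to F 1
    x0, the terminal term to T x0, and the bounded source contributes a multiple of h. *)
Lemma terminal_value F G1 G2 (T : R -> R) x0 (C : R) :
  continuous (uncurry F) -> continuous (uncurry G1) -> continuous (uncurry G2) ->
  continuous T -> (forall t x, `|src G1 G2 t x| <= C) ->
  (forall a b alpha beta c d, bump_on alpha beta a -> 0 < alpha -> bump_on c d b ->
    \int[mu]_(t in I01) (derive1 a t * slice F b t) =
    \int[mu]_(t in I01) (a t * (A t * (slice G1 b t + m t * slice G2 b t))) +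
    a 1 * \int[mu]_x (T x * b x)) ->
  F 1 x0 = T x0.
Proof.
move=> cF c1 c2 cT srcC id; apply/eqP; rewrite -subr_eq0 -normr_le0.
apply/ler_addgt0Pr => eta eta0.
have eta3 : 0 < eta / 3 by rewrite divr_gt0.
have C0 : 0 <= C by exact: le_trans (srcC 0 0).
have [d0 d00 Hd0] := continuous2_dist 1 x0 cF eta3.
have /cvgrPdist_lt/(_ _ eta3)/nbhs_ballP[d2 /= d20 Hd2] := cT x0.
have CC : 0 < (C + 1) * 7 * 3 by rewrite !mulr_gt0// ltr_wpDl.
near (0 : R)^'+ => h.
have h0 : 0 < h by [].
have h1 : 3 * h < 1.
  by rewrite -ltr_pdivlMl//; near: h; apply: nbhs_right_lt; rewrite mulr_gt0.
have hd0 : 2 * h < d0.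
  by rewrite -ltr_pdivlMl//; near: h; apply: nbhs_right_lt; rewrite mulr_gt0.
have hd2 : 2 * h < d2.
  by rewrite -ltr_pdivlMl//; near: h; apply: nbhs_right_lt; rewrite mulr_gt0.
have hC : (C + 1) * 7 * 3 * h < eta.
  by rewrite -ltr_pdivlMl//; near: h; apply: nbhs_right_lt; rewrite mulr_gt0// invr_gt0.
(* With 3 * h the rising flank [1 - 2 * h, 1 - h] lies inside ]0, 1[, while the falling flank
   [1 + h, 1 + 2 * h] lies beyond time 1 and drops out. *)
pose r := 1 - 3 * h.
have r1 : r <= 1 by rewrite /r; clear -cA mm m01 mI h0; lra.
have ba : bump_on (r + h) (1 + 2 * h) (ramp r 1 h) by exact: bump_stpB.
have [sa a0] := ba.
have bk := bump_kern x0 h0.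
have a_pos : 0 < r + h by rewrite /r; clear -cA mm m01 mI h0 h1; lra.
pose S := slice F (kern x0 h).
pose n t := A t * (slice G1 (kern x0 h) t + m t * slice G2 (kern x0 h) t).
have E : \int[mu]_(t in I01) (derive1 (ramp r 1 h) t * S t) =
    \int[mu]_(t in I01) (ramp r 1 h t * n t) + ramp r 1 h 1 * \int[mu]_x (T x * kern x0 h x) :=
  id _ _ _ _ _ _ ba a_pos bk.
have cS : continuous S by exact: slice_continuous bk.
have ikS : mu.-integrable I01 (EFin \o (fun t => S t * kern r h t)).
  have -> : (fun t => S t * kern r h t) = (fun t => kern r h t * S t).
    by apply/funext => t; rewrite mulrC.
  exact: integrable_bump_mul (bump_kern r h0) cS.
have E' : \int[mu]_(t in I01) (derive1 (ramp r 1 h) t * S t) =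
    \int[mu]_(t in I01) (S t * kern r h t).
  apply: eq_Rintegral => t; rewrite inE /I01/= in_itv/= => /andP[_ t1].
  rewrite derive1_ramp (bump_kern 1 h0).2 ?subr0 1?mulrC//.
  by clear -cA mm m01 mI t1 h0; apply/negP => /andP[? ?]; lra.
have a1 : ramp r 1 h 1 = 1.
  rewrite /ramp stp1 ?stp0 ?subr0//; first by clear -cA mm m01 mI h0; lra.
  by rewrite /r; clear -cA mm m01 mI h0; lra.
rewrite {}E' a1 mul1r in E.
have avgF : `|\int[mu]_(t in I01) (S t * kern r h t) - F 1 x0| <= eta / 3.
  apply: kern_average => //.
    move=> t; rewrite /I01/r/= !in_itv/= => /andP[tr1 tr2].
    by clear -cA mm m01 mI tr1 tr2 h0 h1; apply/andP; split; lra.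
  move=> t; rewrite /r => /andP[tr1 tr2]; apply: kern_slice => // y yx; apply/ltW/Hd0.
    by clear -cA mm m01 mI tr1 tr2 h0 hd0; rewrite ler0_norm; lra.
  exact: le_lt_trans hd0.
have avgT : `|\int[mu]_x (T x * kern x0 h x) - T x0| <= eta / 3.
  have [sk k0] := bk; apply: (kern_average measurableT h0 (@subsetT _ _)).
    apply: (@integrable_continuous_support _ _ _ (x0 + h) (x0 + 2 * h)) => //.
      by apply: continuous_mul => //; exact: smooth1_continuous.
    by move=> x xr; rewrite k0// mulr0.
  move=> y /andP[y1 y2]; rewrite distrC; apply/ltW/Hd2.
  by rewrite /ball/=; clear -cA mm m01 mI y1 y2 h0 hd2; rewrite ler0_norm; lra.
have ian : mu.-integrable I01 (EFin \o (fun t => ramp r 1 h t * n t)).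
  apply: (integrable_source cA mm m01 ba); exact: slice_continuous bk.
have age0 t : 0 <= ramp r 1 h t by apply: ramp_ge0 => //; rewrite /r; clear -cA mm m01 mI h0; lra.
have nC t : 0 < t < 1 -> r + h <= t <= 1 + 2 * h -> `|n t - 0| <= C.
  by move=> _ _; apply: source_slice => // y _; rewrite subr0.
have := source_integral ba age0 ian nC; rewrite mul0r subr0.
have ia : mu.-integrable setT (EFin \o ramp r 1 h).
  exact: (integrable_continuous_support measurableT (smooth1_continuous sa) a0).
have aR : \int[mu]_(t in I01) ramp r 1 h t <= \int[mu]_t ramp r 1 h t.
  rewrite [leLHS]Rintegral_mkcond; apply: le_Rintegral => //.
    have iaI : mu.-integrable I01 (EFin \o ramp r 1 h) by apply: (@integrableS _ _ _ mu setT).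
    have := (@integrable_mkcond _ (measurableTypeR R) R mu I01 (EFin \o ramp r 1 h) mI).1 iaI.
    by rewrite restrict_EFin.
  by move=> t _; rewrite patchE; case: ifP.
have mass := ramp_mass h0 r1; have rE : 1 - r = 3 * h by rewrite /r opprB addrCA subrr addr0.
rewrite rE in mass.
move=> aC; exact: (terminal_arith C0 h0 hC aR mass avgF avgT aC E).
Unshelve. all: by end_near. Qed.

End right_derivative.

End pointwise_evolution.

(** * Calculus of right derivatives *)

Section right_derivative_rules.
Context {R : realType}.
Implicit Types (f g : R -> R) (t d e : R).

Lemma right_derive_add f g t d e : right_derive f t d -> right_derive g t e ->
  right_derive (fun s => f s + g s) t (d + e).
Proof.
move=> fd ge; apply: cvg_trans (cvgD fd ge); apply: near_eq_cvg.
by apply: nearW => h /=; rewrite !fctE/=; ring.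
Qed.

Lemma right_derive_opp f t d : right_derive f t d -> right_derive (fun s => - f s) t (- d).
Proof.
move=> fd; apply: cvg_trans (cvgN fd); apply: near_eq_cvg.
by apply: nearW => h /=; rewrite !fctE/=; ring.
Qed.

Lemma right_derive_sqr f t d : {for t, continuous f} -> right_derive f t d ->
  right_derive (fun s => f s ^+ 2) t (2 * f t * d).
Proof.
move=> cf fd.
have fh : f (t + h) @[h --> 0^'+] --> f t.
  have H : t + h @[h --> 0^'+] --> t.
    rewrite -[X in _ --> X]addr0; apply: cvgD; first exact: cvg_cst.
    exact: cvg_within.
  by apply: (@cvg_comp _ _ _ (fun h => t + h) f _ _ _ H); exact cf.
rewrite /right_derive (_ : 2 * f t * d = d * (f t + f t)); last by ring.
apply: cvg_trans (cvgM fd (cvgD fh (cvg_cst (f t)))); apply: near_eq_cvg.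
by apply: nearW => h /=; rewrite !fctE/=; ring.
Qed.

Lemma is_derive_right f t d : is_derive t (1 : R) f d -> right_derive f t d.
Proof.
move=> [ex <-]; have H : h^-1 *: (f (h *: 1 + t) - f t) @[h --> 0^'] --> 'D_1 f t by exact: ex.
rewrite /right_derive; apply: cvg_trans; last exact: (cvg_dnbhs_at_right H).
by apply: near_eq_cvg; near=> h; rewrite [h *: 1]mulr1 [h + t]addrC.
Unshelve. all: by end_near. Qed.

Lemma is_derive_unique f t d e : is_derive t (1 : R) f d -> is_derive t (1 : R) f e -> d = e.
Proof. by move=> [_ <-] [_ <-]. Qed.

End right_derivative_rules.

(** * Continuation to all times *)

Section clamped_time.
Context {R : realType}.
Implicit Types (t x : R).

(* [u] is only controlled for times in [0, 1]; clamping the time gives functions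
   that are continuous on the whole plane. *)
Definition clamp t : R := Num.max 0 (Num.min 1 t).

Lemma clamp_itv t : 0 <= clamp t <= 1.
Proof. by rewrite /clamp le_max lexx/= ge_max ler01 ge_min lexx. Qed.

Lemma clamp_id t : 0 <= t <= 1 -> clamp t = t.
Proof. by move=> /andP[t0 t1]; rewrite /clamp (min_idPr t1) (max_idPr t0). Qed.

Lemma continuous_clamp : continuous clamp.
Proof.
move=> t; apply: (@continuous_max _ _ (cst 0) (fun t => Num.min 1 t)).
  exact: cvg_cst.
by apply: (@continuous_min _ _ (cst 1) id); [exact: cvg_cst | exact: cvg_id].
Qed.

Lemma continuous_clamped (G : R * R -> R) :
  {within `[0, 1] `*` setT, continuous G} ->
  continuous (uncurry (fun t x => G (clamp t, x))).
Proof.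
move=> /subspace_continuousP cG z.
have -> : uncurry (fun t x => G (clamp t, x)) = fun z => G (clamp z.1, z.2).
  by apply/funext => -[].
have cz : (`[0, 1]%classic `*` setT) (clamp z.1, z.2).
  by split => //=; rewrite in_itv/= clamp_itv.
apply: (@cvg_comp _ _ _ (fun z => (clamp z.1, z.2)) G _ _ _ _ (cG _ cz)).
have H : (clamp y.1, y.2) @[y --> nbhs z] --> (clamp z.1, z.2).
  apply: (@cvg_pair _ _ _ _ (nbhs (clamp z.1)) (nbhs z.2)); last exact: cvg_snd.
  by apply: (@continuous_comp _ _ _ fst); [exact: cvg_fst | exact: continuous_clamp].
move=> P; rewrite /within/= => /H; rewrite /nbhs/=; apply: filterS => y; apply.
by split => //=; rewrite in_itv/= clamp_itv.
Qed.

End clamped_time.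

(** * The distribution function of the measure *)

Section distribution_function.
Context {R : realType} (mu : probability (measurableTypeR R) R).
Local Open Scope measure_display_scope.

(** Seen as a random variable, the identity has law [mu], so the facts on cumulative distribution
    functions apply to [distr_fun]. *)
Let idTR : measurableTypeR R -> R := idfun.

#[local] HB.instance Definition _ :=
  @isMeasurableFun.Build _ _ _ _ idTR (@measurable_id _ _ setT).

(** Half-lines give a function that is monotone and right-continuous on the whole line; for a
    measure carried by [0, 1] it equals mu[0, t] when t >= 0. *)
Definition distr_fun (t : R) : R := fine (mu `]-oo, t]).

Let distr_funE t : distr_fun t = fine (cdf (idTR : {RV mu >-> R}) t).
Proof. by []. Qed.

Lemma distr_fun_itv t : 0 <= distr_fun t <= 1.
Proof.
rewrite fine_ge0//= -[leRHS]/(fine 1%E) fine_le ?fin_num_measure//.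
exact: probability_le1.
Qed.

Lemma measurable_distr_fun : measurable_fun setT distr_fun.
Proof.
apply: nondecreasing_measurable => // s t st.
rewrite !distr_funE fine_le ?fin_num_measure// cdf_nondecreasing//.
Qed.

Lemma distr_fun_right_continuous t : distr_fun s @[s --> t^'+] --> distr_fun t.
Proof.
apply: fine_cvg; rewrite fineK ?fin_num_measure//.
exact: (@cdf_right_continuous _ _ _ mu (idTR : {RV mu >-> R})).
Qed.

Lemma distr_fun_unit_interval t : mu `[0, 1] = 1%E -> 0 <= t -> fine (mu `[0, t]) = distr_fun t.
Proof.
move=> mu1 t0; rewrite /distr_fun; congr fine.
have mneg : mu `]-oo, 0[ = 0%E.
  have mI : measurable (`[0, 1]%classic : set (measurableTypeR R)) by exact: measurable_itv.
  have := probability_setC mu mI.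
  rewrite mu1 subee// => H; apply/eqP; rewrite -measure_le0 -[leRHS]H.
  apply: le_measure; rewrite ?inE//; first exact: measurableC.
  by move=> x /=; rewrite !in_itv/= => x0; rewrite leNgt x0.
rewrite (@itv_bndbnd_setU _ _ -oo%O (BLeft 0) (BRight t))//.
rewrite measureU//.
  by rewrite -[LHS]add0e; congr (_ + _)%E; exact/esym/mneg.
apply/seteqP; split => // x [] /=; rewrite !in_itv/= => x0 /andP[].
by rewrite leNgt x0.
Qed.

End distribution_function.

(** * Bounds on the derivatives *)

Section derivative_bounds.
Context {R : realType}.
Notation mu := (@lebesgue_measure R).
Implicit Types (F G : R -> R -> R) (s t x : R).

Lemma continuous_uncurry_mul F G : continuous (uncurry F) -> continuous (uncurry G) ->
  continuous (uncurry (fun t x => F t x * G t x)).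
Proof.
move=> cF cG z; rewrite (_ : uncurry _ = (fun z => uncurry F z * uncurry G z)).
  by apply: cvgM; [exact: cF | exact: cG].
by apply/funext => -[].
Qed.

Lemma continuous_uncurry_add F G : continuous (uncurry F) -> continuous (uncurry G) ->
  continuous (uncurry (fun t x => F t x + G t x)).
Proof.
move=> cF cG z; rewrite (_ : uncurry _ = (fun z => uncurry F z + uncurry G z)).
  by apply: cvgD; [exact: cF | exact: cG].
by apply/funext => -[].
Qed.

Lemma continuous_uncurry_cst (c : R) : continuous (uncurry (fun _ _ : R => c)).
Proof.
move=> z; rewrite (_ : uncurry _ = cst c); first exact: cvg_cst.
by apply/funext => -[].
Qed.

Lemma continuous_lncosh : continuous (fun x : R => ln (cosh x)).
Proof.
move=> x; apply/differentiable_continuous/derivable1_diffP.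
exact: (@ex_derive _ _ _ _ _ _ _ (is_derive_lncosh x)).
Qed.

(* The operator [f_t + A * (f_xx + 2 * m * p * f_x)] applied to [w + p ^+ 2], where
   [u3] and [u4] are the third and fourth space derivatives of [u]. *)
Lemma sum_operator (A m p w u3 u4 : R) :
  - (A * (u4 + m * (2 * w ^+ 2 + 2 * p * u3))) + 2 * p * - (A * (u3 + m * (2 * p * w))) +
    A * (u4 + (2 * w ^+ 2 + 2 * p * u3) + 2 * m * p * (u3 + 2 * p * w)) =
  2 * A * (1 - m) * w ^+ 2.
Proof. by ring. Qed.

(** The operator above applied to g * sech^2 - w, with [th] for tanh x and sech^2 = 1 - th^2. The
    terms in [u3] and [u4] cancel. What may be negative is at worst - A * (2 + 4 * M) * g * sech^2,
    which the growth rate S * (2 + 4 * M) of g compensates. *)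
Lemma barrier_operator (A S M m p w u3 u4 g th : R) : 0 <= A <= S -> 0 <= m <= 1 ->
  `|p| <= M -> `|th| <= 1 -> 0 <= g ->
  0 <= S * (2 + 4 * M) * (g * (1 - th ^+ 2)) + A * (u4 + m * (2 * w ^+ 2 + 2 * p * u3)) +
    A * (g * (- 2 * (1 - th ^+ 2) ^+ 2 + 4 * th ^+ 2 * (1 - th ^+ 2)) - u4 +
         2 * m * p * (g * (- 2 * th * (1 - th ^+ 2)) - u3)).
Proof.
move=> /andP[A0 AS] /andP[m0 m1] pM th1 g0.
have th2 : 0 <= th ^+ 2 <= 1.
  by rewrite sqr_ge0/= -real_normK ?num_real// expr_le1.
have /andP[q0 q1] := th2.
set s := 1 - th ^+ 2.
have s0 : 0 <= s by rewrite subr_ge0.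
have s1 : s <= 1 by rewrite gerBl.
have mp : `|m * p * th| <= M.
  rewrite !normrM (ger0_norm m0) -mulrA -[leRHS]mul1r ler_pM//.
  by rewrite -[leRHS]mulr1 ler_pM.
have E : S * (2 + 4 * M) * (g * s) + A * (u4 + m * (2 * w ^+ 2 + 2 * p * u3)) +
    A * (g * (- 2 * s ^+ 2 + 4 * th ^+ 2 * s) - u4 + 2 * m * p * (g * (- 2 * th * s) - u3)) =
  g * s * (S * (2 + 4 * M) - A * (2 * s + 4 * (m * p * th))) + 4 * (g * s * A * th ^+ 2)
    + 2 * (A * m * w ^+ 2).
  by ring.
have w2 := sqr_ge0 w; have gs0 : 0 <= g * s by exact: mulr_ge0.
rewrite E; apply: addr_ge0; last by rewrite mulr_ge0// mulr_ge0// mulr_ge0.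
apply: addr_ge0; last by rewrite mulr_ge0// mulr_ge0// mulr_ge0.
apply: mulr_ge0; first exact: mulr_ge0.
rewrite subr_ge0; have M0 : 0 <= M by exact: le_trans pM.
apply: (@le_trans _ _ (A * (2 + 4 * M))); last first.
  by rewrite ler_wpM2r// addr_ge0// mulr_ge0.
apply: ler_wpM2l => //; apply: lerD.
  by rewrite -[leRHS]mulr1 ler_wpM2l.
by rewrite ler_wpM2l// (le_trans (ler_norm _)).
Qed.

(** [U j] plays the role of the j-th space derivative of u, continued to all times, so that every
    hypothesis is global. *)
Lemma parisi_derivative_bounds (U : nat -> R -> R -> R) (A m : R -> R) (S : R) :
  (forall j, continuous (uncurry (U j))) ->
  (forall j t x, is_derive x (1 : R) (U j t) (U j.+1 t x)) ->
  (forall j, exists M, forall t x, `|U j.+1 t x| <= M) ->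
  continuous A -> (forall t, 0 <= A t <= S) ->
  measurable_fun setT m -> (forall t, 0 <= m t <= 1) ->
  (forall t, m s @[s --> t^'+] --> m t) ->
  (forall a b alpha beta c d, bump_on alpha beta a -> 0 < alpha -> bump_on c d b ->
    \int[mu]_(t in `]0, 1[) (derive1 a t * slice (U 0) b t) =
    \int[mu]_(t in `]0, 1[) (a t * (A t * (slice (U 0) (derive1 (derive1 b)) t +
       m t * slice (fun t x => U 1 t x ^+ 2) b t))) +
    a 1 * \int[mu]_x (ln (cosh x) * b x)) ->
  forall t x, 0 <= t <= 1 -> `|U 1 t x| < 1 /\ 0 < U 2 t x <= 1.
Proof.
move=> cU dU bU cA AS mm m01 mr teq.
have cc := continuous_uncurry_cst.
have cM := continuous_uncurry_mul; have cD := continuous_uncurry_add.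
pose Q0 t x := U 1 t x ^+ 2.
pose Q1 t x := 2 * U 1 t x * U 2 t x.
pose Q2 t x := 2 * U 2 t x ^+ 2 + 2 * U 1 t x * U 3 t x.
have cQ0 : continuous (uncurry Q0) by exact: cM.
have cQ1 : continuous (uncurry Q1) by apply: (cM); [apply: (cM) |].
have cQ2 : continuous (uncurry Q2).
  by apply: (cD); [apply: (cM) => //; exact: (cM) | apply: (cM) => //; exact: (cM)].
have dQ0 t x : is_derive x (1 : R) (Q0 t) (Q1 t x).
  apply: (is_derive_congr (is_derive_mul (dU 1 t x) (dU 1 t x))) => [y|].
    by rewrite /Q0 expr2.
  by rewrite /Q1; ring.
have dQ1 t x : is_derive x (1 : R) (Q1 t) (Q2 t x).
  apply: (is_derive_congr (is_derive_mul (is_derive_cst (2 : R) x 1)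
    (is_derive_mul (dU 1 t x) (dU 2 t x)))) => [y|].
    by rewrite /Q1 /cst mulrA.
  by rewrite /Q2 /cst; ring.
have sl b c d t : bump_on c d b -> slice (U 0) (derive1 (derive1 b)) t = slice (U 2) b t.
  move=> bb; rewrite (slice_by_parts (cU 1) (dU 0 t) (bump_derive1 bb)).
  by rewrite (slice_by_parts (cU 2) (dU 1 t) bb) opprK.
have teq' a b alpha beta c d : bump_on alpha beta a -> 0 < alpha -> bump_on c d b ->
    \int[mu]_(t in `]0, 1[) (derive1 a t * slice (U 0) b t) =
    \int[mu]_(t in `]0, 1[) (a t * (A t * (slice (U 2) b t + m t * slice Q0 b t))) +
    a 1 * \int[mu]_x (ln (cosh x) * b x).
  move=> ba a0 bb; rewrite (teq _ _ _ _ _ _ ba a0 bb); congr (_ + _).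
  by apply: eq_Rintegral => t _; rewrite (sl _ _ _ _ bb).
have id0 : interior_identity A m (U 0) (U 2) Q0.
  move=> a b alpha beta c d ba a0 b1 bb; rewrite (teq' _ _ _ _ _ _ ba a0 bb).
  by rewrite ba.2 ?mul0r ?addr0// negb_and -!ltNge b1 orbT.
have id1 : interior_identity A m (U 1) (U 3) Q1.
  exact: (interior_identity_derive cA mm m01 (cU 1) (cU 3) cQ1 (dU 0) (dU 2) dQ0 id0).
have id2 : interior_identity A m (U 2) (U 4) Q2.
  exact: (interior_identity_derive cA mm m01 (cU 2) (cU 4) cQ2 (dU 1) (dU 3) dQ1 id1).
have [M1 HM1] := bU 0; have [M2 HM2] := bU 1.
have M10 : 0 <= M1 by exact: le_trans (HM1 0 0).
have S0 : 0 <= S by have /andP[a0 aS] := AS 0; exact: le_trans aS.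
have Q0M t x : Q0 t x <= M1 ^+ 2.
  by rewrite /Q0 -real_normK ?num_real// lerXn2r ?nnegrE.
have U0T x : U 0 1 x = ln (cosh x).
  apply: (@terminal_value _ A m cA mm m01 (U 0) (U 2) Q0 (fun x => ln (cosh x)) x (S * (M2 + M1 ^+ 2))) => //.
    exact: continuous_lncosh.
  move=> t y; have /andP[a0 aS] := AS t; have /andP[m0 m1] := m01 t.
  rewrite normrM ger0_norm// ler_pM//; apply: le_trans (ler_normD _ _) _.
  apply: lerD; first exact: HM2.
  have q0 : `|Q0 t y| <= M1 ^+ 2 by rewrite ger0_norm; [exact: Q0M | exact: sqr_ge0].
  by rewrite normrM (ger0_norm m0) -[leRHS]mul1r ler_pM.
have U1T x : U 1 1 x = tanh x.
  have E : U 0 1 =1 (fun x => ln (cosh x)) by exact: U0T.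
  have := dU 0 1 x; rewrite (funext E) => H.
  exact: (is_derive_unique H (is_derive_lncosh x)).
have U2T x : U 2 1 x = 1 - tanh x ^+ 2.
  have E : U 1 1 =1 tanh by exact: U1T.
  have := dU 1 1 x; rewrite (funext E) => H.
  exact: (is_derive_unique H (is_derive_tanh x)).
have rd1 t x : 0 <= t < 1 ->
    right_derive (U 1 ^~ x) t (- (A t * (U 3 t x + m t * Q1 t x))).
  by move=> t01; apply: (identity_right_derive cA mm m01 _ _ _ id1 t01 (mr t)).
have rd2 t x : 0 <= t < 1 ->
    right_derive (U 2 ^~ x) t (- (A t * (U 4 t x + m t * Q2 t x))).
  by move=> t01; apply: (identity_right_derive cA mm m01 _ _ _ id2 t01 (mr t)).
have cUr j x : continuous (U j ^~ x) by exact: continuous_uncurryr (cU j).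
have Bbound t x : `|2 * m t * U 1 t x| <= 2 * M1.
  have /andP[m0 m1] := m01 t.
  rewrite !normrM (ger0_norm m0) ger0_norm// -mulrA ler_pM2l// -[leRHS]mul1r.
  by rewrite ler_pM.
have upper : forall t x, 0 <= t <= 1 -> U 2 t x + Q0 t x - 1 <= 0.
  apply: (@maximum_principle _ _ S (2 * M1) (M2 + M1 ^+ 2)) => //.
  - by rewrite mulr_ge0.
  - by apply: (cD) => //; exact: (cD).
  - move=> t x _; have := Q0M t x; have := le_trans (ler_norm _) (HM2 t x).
    by clear; lra.
  - by move=> x; rewrite U2T /Q0 U1T subrK subrr.
  move=> t x t01.
  exists (- (A t * (U 4 t x + m t * Q2 t x)) + 2 * U 1 t x * - (A t * (U 3 t x + m t * Q1 t x))).
  exists (fun y => U 3 t y + Q1 t y), (U 4 t x + Q2 t x), (A t), (2 * m t * U 1 t x); split.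
  - rewrite -[X in right_derive _ _ X]addr0.
    exact: (right_derive_add (right_derive_add (rd2 t x t01)
      (right_derive_sqr (cUr 1%N x t) (rd1 t x t01)))
      (is_derive_right (is_derive_cst (- 1 : R) t 1))).
  - move=> y; apply: (is_derive_congr (is_derive_sub (is_derive_add (dU 2%N t y) (dQ0 t y))
      (is_derive_cst (1 : R) y 1))) => //.
    by rewrite subr0.
  - exact: (is_derive_add (dU 3%N t x) (dQ1 t x)).
  - by split.
  - rewrite /Q1 /Q2 sum_operator; have /andP[a0 _] := AS t; have /andP[_ m1] := m01 t.
    by rewrite mulr_ge0 ?sqr_ge0// mulr_ge0 ?subr_ge0// mulr_ge0.
pose K := S * (2 + 4 * M1).
have K0 : 0 <= K by rewrite mulr_ge0// addr_ge0// mulr_ge0.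
(* Normalised by g 1 = 1, so that the barrier coincides with w at time 1 and stays below 1 on
   [0, 1]. *)
pose g t : R := expR (K * t + - K).
pose sech2 x : R := 1 - tanh x ^+ 2.
have sech2_gt0 x : 0 < sech2 x by rewrite subr_gt0 tanh2_lt1.
have dsech2 x : is_derive x (1 : R) sech2 (- 2 * tanh x * (1 - tanh x ^+ 2)).
  apply: (is_derive_congr (is_derive_sub (is_derive_cst (1 : R) x 1)
    (is_derive_mul (is_derive_tanh x) (is_derive_tanh x)))) => [y|].
    by rewrite /sech2 expr2.
  by ring.
have ddsech2 x : is_derive x (1 : R) (fun y => - 2 * tanh y * (1 - tanh y ^+ 2))
    (- 2 * (1 - tanh x ^+ 2) ^+ 2 + 4 * tanh x ^+ 2 * (1 - tanh x ^+ 2)).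
  apply: (is_derive_congr (is_derive_mul (is_derive_cst (- 2 : R) x 1)
    (is_derive_mul (is_derive_tanh x) (dsech2 x)))) => [y|].
    by rewrite /cst mulrA.
  by rewrite /sech2 /cst; ring.
have dg t : is_derive t (1 : R) g (expR (K * t + - K) * K).
  exact: is_derive_comp_affine (is_derive_expR _).
have lower : forall t x, 0 <= t <= 1 -> g t * sech2 x - U 2 t x <= 0.
  apply: (@maximum_principle _ _ S (2 * M1) (1 + M2)) => //.
  - by rewrite mulr_ge0.
  - move=> z; rewrite (_ : uncurry _ = (fun z => g z.1 * sech2 z.2 - uncurry (U 2) z)).
      apply: cvgB; last exact: cU.
      apply: cvgM.
        apply: (@continuous_comp _ _ _ fst); first exact: cvg_fst.
        apply/differentiable_continuous/derivable1_diffP.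
        exact: (@ex_derive _ _ _ _ _ _ _ (dg _)).
      apply: (@continuous_comp _ _ _ snd); first exact: cvg_snd.
      apply/differentiable_continuous/derivable1_diffP.
      exact: (@ex_derive _ _ _ _ _ _ _ (dsech2 _)).
    by apply/funext => -[].
  - move=> t x /andP[t0 t1]; apply: lerD.
      have g1 : g t <= 1.
        by rewrite /g expR_le1 subr_le0 -[leRHS]mulr1 ler_wpM2l.
      rewrite -[leRHS]mulr1 ler_pM ?expR_ge0//; first exact: ltW.
      by rewrite /sech2 gerBl sqr_ge0.
    by rewrite (le_trans (ler_norm _))// normrN.
  - by move=> x; rewrite U2T /g mulr1 subrr expR0 mul1r subrr.
  move=> t x t01.
  exists (K * (g t * (1 - tanh x ^+ 2)) + A t * (U 4 t x + m t * Q2 t x)).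
  exists (fun y => g t * (- 2 * tanh y * (1 - tanh y ^+ 2)) - U 3 t y).
  exists (g t * (- 2 * (1 - tanh x ^+ 2) ^+ 2 + 4 * tanh x ^+ 2 * (1 - tanh x ^+ 2)) - U 4 t x).
  exists (A t), (2 * m t * U 1 t x); split.
  - apply: right_derive_add.
      apply: is_derive_right.
      apply: (is_derive_congr (is_derive_mul (dg t) (is_derive_cst (sech2 x) t 1))) => //.
      by rewrite mulr0 addr0 /cst /g /sech2; ring.
    by rewrite -[X in right_derive _ _ X]opprK; apply: right_derive_opp; exact: rd2.
  - move=> y; apply: (is_derive_congr (is_derive_sub
      (is_derive_mul (is_derive_cst (g t) y 1) (dsech2 y)) (dU 2%N t y))) => //.
    by rewrite mul0r add0r.
  - apply: (is_derive_congr (is_derive_sub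
      (is_derive_mul (is_derive_cst (g t) x 1) (ddsech2 x)) (dU 3%N t x))) => //.
    by rewrite mul0r add0r.
  - by split.
  - by apply: barrier_operator => //; [exact/ltW/norm_tanh_lt1 | exact: expR_ge0].
move=> t x t01.
have w0 : 0 < U 2 t x.
  have := lower t x t01; rewrite subr_le0; apply: lt_le_trans.
  by rewrite mulr_gt0// expR_gt0.
have := upper t x t01; rewrite subr_le0 => H.
split.
  rewrite -(@ltr_pXn2r _ 2)// ?nnegrE// expr1n real_normK ?num_real//.
  by apply: lt_le_trans H; rewrite ltrDr.
by rewrite w0/= (le_trans _ H)// lerDl sqr_ge0.
Qed.

End derivative_bounds.

(** * Transfer to the solution of the Parisi PDE *)

Theorem lemma16 (R : realType) (beta : nat -> R) (eps : R)
    (mu : probability (measurableTypeR R) R) (u : R -> R -> R)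
    (eps_gt0 : 0 < eps)
    (xi_finite : (\sum_(1 <= p <oo) (beta p ^+ 2 * (1 + eps) ^+ p)%:E < +oo)%E)
    (mu_unit_interval : mu `[0, 1] = 1%E)
    (u_solution : parisi_solution (xi beta) mu u)
    (u_regular : bounded_space_derivatives u) :
  forall t x : R, 0 <= t <= 1 ->
    `|derive1 (u t) x| < 1 /\ 0 < derive1n 2 (u t) x <= 1.
Proof.
have [dU bU] := u_regular; have [cu [v [weak_v bounded_v eqn]]] := u_solution.
pose U j t x := derive1n j (u (clamp t)) x.
pose A t := derive1n 2 (xi beta) (clamp t) / 2.
have ccl := @continuous_clamp R.
have cU j : continuous (uncurry (U j)).
  case: j => [|j].
    exact: (continuous_clamped cu).
  exact: (continuous_clamped (bU j.+1 isT).1).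
have dUj j t x : is_derive x (1 : R) (U j t) (U j.+1 t x).
  by rewrite /U derive1nS derive1E; apply: derivableP; apply: dU; exact: clamp_itv.
have bUj j : exists M, forall t x, `|U j.+1 t x| <= M.
  have [_ [M HM]] := bU j.+1 isT; exists M => t x; apply: HM; exact: clamp_itv.
have xi2 := xi_second_derivative eps_gt0 xi_finite.
have cA : continuous A.
  move=> t; apply: cvgM; last exact: cvg_cst.
  apply: (@continuous_comp _ _ _ clamp (derive1n 2 (xi beta))); first exact: ccl.
  exact: (xi2 _ (clamp_itv t)).2.
have A0 t : 0 <= A t by rewrite divr_ge0//; exact: (xi2 _ (clamp_itv t)).1.
(* [A] factors through [clamp], so a bound on [0, 1] holds at all times. *)
have [S HS] := continuous_bounded_segment 0 1 cA.
have AS t : 0 <= A t <= S.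
  rewrite A0/=; have -> : A t = A (clamp t) by rewrite /A (clamp_id (clamp_itv t)).
  by rewrite (le_trans (ler_norm _))// HS// clamp_itv.
(* The weak formulation sees [u] only at times in ]0, 1[, where clamping changes nothing. *)
have UE j t : t \in `]0 : R, 1[%classic -> derive1n j (u t) = U j t.
  rewrite inE/= in_itv/= => /andP[t0 t1]; apply/funext => x.
  by rewrite /U clamp_id// !ltW.
have weak_U : weak_px (U 0%N) v.
  move=> phi test_phi; rewrite -(weak_v phi test_phi); apply: eq_Rintegral => t tI.
  have E : u t = U 0%N t := UE 0%N t tI.
  by rewrite E.
have [M HM] := bUj 0%N.
have vU := weak_px_unique (cU 0%N) (cU 1%N) (dUj 0%N) HM weak_U bounded_v.
have teq := tensor_weak_equation cA (measurable_distr_fun mu) (distr_fun_itv mu) (cU 0%N) (cU 1%N) vU.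
have bounds : forall t x, 0 <= t <= 1 -> `|U 1%N t x| < 1 /\ 0 < U 2%N t x <= 1.
  refine (parisi_derivative_bounds cU dUj bUj cA AS (measurable_distr_fun mu) (distr_fun_itv mu)
    (distr_fun_right_continuous (mu:=mu)) (teq _)) => phi test_phi.
  refine (eq_trans (eqn phi test_phi) _).
  refine (f_equal2 +%R _ erefl).
  apply: eq_Rintegral => t tI; apply: eq_Rintegral => x _.
  have E : u t = U 0%N t := UE 0%N t tI.
  rewrite E.
  move: tI; rewrite inE/= in_itv/= => /andP[t0 t1].
  by rewrite (distr_fun_unit_interval mu_unit_interval (ltW t0)) /A clamp_id// !ltW.
by move=> t x t01; have := bounds t x t01; rewrite /U clamp_id.
Qed.
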